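(* Let $T,d\ge1$, $\gamma>0$, $\beta>0$. For each task $t\in\{1,\dots,T\}$ let $(x_{t1},y_{t1}),\dots,(x_{tm_t},y_{tm_t})\in\mathbb{R}^d\times\mathbb{R}$ be independent samples drawn from a task-specific distribution, and write $X_t=[x_{t1},\dots,x_{tm_t}]$. Let $l$ be a loss with $0\le l(y,f(x))\le B$ for all arguments, which is $c$-admissible with respect to the class of linear functions. Let $(A,a_0,U)$, with $A=[a_1,\dots,a_T]\in\mathbb{R}^{d\times T}$, $a_0\in\mathbb{R}^d$ and $U\in\mathbb{R}^{d\times d}$ orthogonal, be an optimal solution of $$\min_{A,a_0,U}\ \sum_{t=1}^{T}\sum_{i=1}^{m_t} l\big(y_{ti},\langle a_t+a_0,U^Tx_{ti}\rangle\big)\quad\text{s.t.}\quad \|A\|_{2,1}^2\le \frac{T}{\gamma},\ \ \|a_0\|_2^2\le\frac1\beta,\ \ U^TU=I.$$ Then for any $\delta>0$, with probability at least $1-\delta$, $$E_x\sum_{t=1}^{T}\sum_{i=1}^{m_t}l\big(y_{ti},\langle a_t+a_0,U^Tx_{ti}\rangle\big)-\sum_{t=1}^{T}\sum_{i=1}^{m_t}l\big(y_{ti},\langle a_t+a_0,U^Tx_{ti}\rangle\big)\le 2c\left(\sqrt{\frac{T}{\gamma}}+\sqrt{\frac1\beta}\right)\sqrt{\sum_{t=1}^{T}m_tS(X_t)}+3B\sqrt{\frac{\sum_{t=1}^{T}m_t\ln(2/\delta)}{2}},$$ where $S(X_t)=\frac{1}{m_t}\sum_{i=1}^{m_t}\|x_{ti}\|_2^2$.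 Moreover, if $m_1=\dots=m_T=m$ and $\|x_t\|_2\le r$ for all $t$, then with probability at least $1-\delta$, $$\frac1T\sum_{t=1}^{T}E_x\,l\big(y_t,\langle a_t+a_0,U^Tx_t\rangle\big)-\frac1T\sum_{t=1}^{T}\frac1m\sum_{i=1}^{m}l\big(y_{ti},\langle a_t+a_0,U^Tx_{ti}\rangle\big)\le\frac{2cr}{\sqrt{\gamma m}}+\frac{2cr}{\sqrt{\beta mT}}+3B\sqrt{\frac{\ln(2/\delta)}{2mT}}.$$
   Context: For $A\in\mathbb{R}^{d\times T}$ with rows $a^1,\dots,a^d$, $\|A\|_{2,1}=\sum_{i=1}^d\|a^i\|_2$. A loss $l$ is $c$-admissible with respect to a hypothesis class $H$ if there is $c\ge0$ such that for all $h,h'\in H$ and all $(x,y)$, $|l(y,h(x))-l(y,h'(x))|\le c|h(x)-h'(x)|$. $E_x$ denotes expectation with respect to the data distribution (over fresh samples of each task); $(x_t,y_t)$ denotes a random sample from task $t$. *)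

(* Defs.v *)
From HB Require Import structures.
From mathcomp Require Import all_boot all_order all_algebra.
From mathcomp Require Import all_classical all_reals all_analysis.
Set Implicit Arguments. Unset Strict Implicit. Unset Printing Implicit Defensive.
Import Order.TTheory GRing.Theory Num.Theory.
Local Open Scope classical_set_scope.
Local Open Scope ring_scope.

Section defs.
Variable R : realType.

(* a point of R^d, stored as a d-tuple (measurable structure from the library),
   seen as a column vector *)
Definition vec_of (d : nat) (x : d.-tuple R) : 'cV[R]_d := \col_i tnth x i.

Definition dotv (d : nat) (u v : 'cV[R]_d) : R := \sum_(i < d) u i 0 * v i 0.
Definition sqnorm (d : nat) (u : 'cV[R]_d) : R := dotv u u.
Definition norm2 (d : nat) (u : 'cV[R]_d) : R := Num.sqrt (sqnorm u).

Definition norm21 (d T : nat) (A : 'M[R]_(d, T)) : R :=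
  \sum_(i < d) Num.sqrt (\sum_(j < T) A i j ^+ 2).

Definition admissible_linear (d : nat) (l : R -> R -> R) (c : R) : Prop :=
  0 <= c /\
  forall (w w' : 'cV[R]_d) (x : 'cV[R]_d) (y : R),
    `| l y (dotv w x) - l y (dotv w' x) | <= c * `| dotv w x - dotv w' x |.

Definition predict (d T : nat) (A : 'M[R]_(d, T)) (a0 : 'cV[R]_d) (U : 'M[R]_d)
  (t : 'I_T) (x : d.-tuple R) : R :=
  dotv (col t A + a0) (U^T *m vec_of x).

Definition feasible (d T : nat) (gamma beta : R)
  (A : 'M[R]_(d, T)) (a0 : 'cV[R]_d) (U : 'M[R]_d) : Prop :=
  norm21 A ^+ 2 <= T%:R / gamma /\ sqnorm a0 <= beta^-1 /\ U^T *m U = 1%:M.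

Definition emp_obj (d T : nat) (m : 'I_T -> nat) (l : R -> R -> R)
  (s : forall t : 'I_T, 'I_(m t) -> (d.-tuple R * R)%type)
  (A : 'M[R]_(d, T)) (a0 : 'cV[R]_d) (U : 'M[R]_d) : R :=
  \sum_(t < T) \sum_(i < m t) l (s t i).2 (predict A a0 U t (s t i).1).

Definition S_t (d : nat) (mt : nat) (xs : 'I_mt -> d.-tuple R) : R :=
  mt%:R^-1 * \sum_(i < mt) sqnorm (vec_of (xs i)).
End defs.

(* mutual independence of a finite family of random elements:
   product rule for every family of measurable sets (taking setT for some
   indices gives the product rule for every subfamily) *)
Definition mutually_independent (R : realType) (dO : measure_display)
  (Omega : measurableType dO) (P : probability Omega R)
  (dZ : measure_display) (Zt : measurableType dZ) (I : finType)
  (Z : I -> Omega -> Zt) : Prop :=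
  forall B : I -> set Zt, (forall i, measurable (B i)) ->
    P (\bigcap_(i in [set: I]) (Z i @^-1` B i)) = (\prod_(i : I) P (Z i @^-1` B i))%E.

(* Main.v *)
Require Import Defs.
From HB Require Import structures.
From mathcomp Require Import all_boot all_order all_algebra.
From mathcomp Require Import all_classical all_reals all_analysis.
From mathcomp Require Import measurable_realfun ring lra.
Import Order.TTheory GRing.Theory Num.Theory.
Import numFieldNormedType.Exports.
Local Open Scope classical_set_scope.
Local Open Scope ring_scope.

(** Rotating by [U] turns the feasible set into a subset of the pairs [(A, a)]
    with [A] in a Frobenius ball of squared radius [T / gamma] and [a] in a
    Euclidean ball of squared radius [1 / beta], because [||A||_F <= ||A||_(2,1)].
    For a finite class of such pairs let [Phi] be the largest deviation of the
    expected from the empirical loss and [Rad] the Rademacher average of twice the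
    losses. Changing one sample changes [Phi - Rad] by at most [3 B], and its
    expectation is nonpositive by symmetrization, so one application of
    McDiarmid's inequality (iterated Hoeffding lemma) gives
    [Phi <= Rad + 3 B sqrt (n ln (2 / delta) / 2)]. Contraction and the concavity
    of the square root bound [Rad] by [2 c (sqrt (T / gamma) + sqrt (1 / beta))
    sqrt (sum ||x||^2)], which does not depend on the class. Rational pairs are
    dense in the product of balls, and the deviation is continuous in the pair by
    dominated convergence; a limsup of the events of an increasing sequence of
    finite classes thus gives one event on which the bound holds for all feasible
    points, however the solution is selected. *)

(** * Independent samples as tuples *)

Definition box {Zt : Type} (n : nat) (B : 'I_n -> set Zt) : set (n.-tuple Zt) :=
  [set x | forall i, B i (tnth x i)].

Lemma bigcap_ordS {T : Type} (n : nat) (F : 'I_n.+1 -> set T) :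
  \bigcap_(i in [set: 'I_n.+1]) F i =
  F ord0 `&` \bigcap_(i in [set: 'I_n]) F (lift ord0 i).
Proof.
apply/seteqP; split=> [x Fx|x [F0 FS] i _].
  by split=> [|i _]; exact: Fx.
by case: (unliftP ord0 i) => [j ->|->//]; exact: FS.
Qed.

Lemma box_bigcap {Zt : Type} (n : nat) (B : 'I_n -> set Zt) :
  box n B = \bigcap_(i in [set: 'I_n]) ((fun x => tnth x i) @^-1` B i).
Proof. by apply/seteqP; split => x Bx i => [_|]; exact: Bx. Qed.

Section tuple_measure.
Context {dZ : measure_display} {Zt : measurableType dZ}.

Lemma measurable_box (n : nat) (B : 'I_n -> set Zt) :
  (forall i, measurable (B i)) -> measurable (box n B).
Proof.
move=> mB; rewrite box_bigcap; apply: fin_bigcap_measurable => // i _.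
by rewrite -[X in measurable X]setTI; exact: measurable_tnth.
Qed.

(** The library generates this sigma-algebra by sets constraining a single coordinate, a family not
    closed under intersection. Boxes form a pi-system, as uniqueness of measures requires; a
    one-coordinate set is a box whose other sides are [setT]. *)
Lemma measurable_tuple_box (n : nat) :
  @measurable _ (n.-tuple Zt) =
  <<s [set C | exists2 B, (forall i, measurable (B i)) & C = box n B] >>.
Proof.
apply/seteqP; split.
  apply: smallest_sub; first exact: smallest_sigma_algebra.
  move=> C; rewrite -bigcup_seq => -[i _] [B mB <-].
  apply: sub_sigma_algebra; exists (fun j => if j == i then B else setT).
    by move=> j; case: ifP.
  apply/seteqP; split => x /=.
    by move=> [_ Bx] j; case: eqP => [->|].
  by move=> /(_ i); rewrite eqxx.
apply: smallest_sub; first exact: sigma_algebra_measurable.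
by move=> _ [B mB ->]; exact: measurable_box.
Qed.

Lemma measure_tuple_unique {R : realType} (n : nat)
    (m1 m2 : probability (n.-tuple Zt) R) :
  (forall B, (forall i, measurable (B i)) -> m1 (box n B) = m2 (box n B)) ->
  forall C, measurable C -> m1 C = m2 C.
Proof.
move=> m12; apply: (measure_unique _ (fun=> setT) (measurable_tuple_box n)).
- move=> _ _ [B mB ->] [B' mB' ->].
  exists (fun i => B i `&` B' i); first by move=> i; exact: measurableI.
  by apply/seteqP; split=> x /= => [[Bx Bx'] i|Bx]; [split|split=> i; case: (Bx i)].
- by move=> _; exists (fun=> setT) => //; apply/seteqP; split.
- by rewrite bigcup_const.
- by move=> _ [B mB ->]; exact: m12.
- by move=> _ /=; rewrite probability_setT ltry.
Qed.

End tuple_measure.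

Section sample.
Context {R : realType} {dO : measure_display} {Omega : measurableType dO}.
Context {P : probability Omega R}.
Context {dZ : measure_display} {Zt : measurableType dZ}.

Definition sample (n : nat) (X : 'I_n -> Omega -> Zt) (w : Omega) : n.-tuple Zt :=
  [tuple X i w | i < n].

Lemma measurable_sample (n : nat) (X : 'I_n -> Omega -> Zt) :
  (forall i, measurable_fun setT (X i)) -> measurable_fun setT (sample n X).
Proof.
move=> mX; apply: (proj2 (measurable_fun_tnthP _)) => i.
rewrite (_ : _ \o _ = X i) //; apply/funext => w; exact: tnth_mktuple.
Qed.

(** Assigning [setT] to the first coordinate turns its factor in the product rule into 1. *)
Lemma mutually_independent_lift (n : nat) (X : 'I_n.+1 -> Omega -> Zt) :
  mutually_independent P X -> mutually_independent P (fun i => X (lift ord0 i)).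
Proof.
move=> iX B mB; have := iX (fun j => oapp B setT (unlift ord0 j)).
rewrite bigcap_ordS unlift_none /= preimage_setT setTI.
under [X in P X = _]eq_bigcapr do rewrite liftK /=.
move=> ->; last by move=> j; case: unlift => [i|] /=; [exact: mB|].
rewrite big_ord_recl unlift_none /= preimage_setT probability_setT mul1e.
by under eq_bigr do rewrite liftK.
Qed.

Lemma bounded_integrable (f : Omega -> R) (M : R) : measurable_fun setT f ->
  (forall w, `|f w| <= M) -> P.-integrable setT (EFin \o f).
Proof.
move=> mf fM; apply: measurable_bounded_integrable => //.
  by rewrite ltey_eq fin_num_measure.
by exists M; split; [exact: num_real|move=> x Mx w _; exact: le_trans (fM w) (ltW Mx)].
Qed.

End sample.

Section bounded_integral.
Context {R : realType} {dO : measure_display} {Omega : measurableType dO}.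
Context (P : probability Omega R).
Context (f : Omega -> R) (mf : measurable_fun setT f).

Lemma Rintegral_probability_cst (a : R) : (\int[P]_w a)%R = a.
Proof. by rewrite Rintegral_cst //= -[X in fine X]/(P setT) probability_setT mulr1. Qed.

Lemma Rintegral_norm_le (M : R) : (forall w, `|f w| <= M) ->
  `|\int[P]_w f w|%R <= M.
Proof.
move=> fM; have fi := bounded_integrable (P:=P) f M mf fM.
apply: le_trans (le_normr_Rintegral _ fi) _ => //.
rewrite -[leRHS]Rintegral_probability_cst; apply: le_Rintegral => //.
  exact: integrable_norm.
apply: (bounded_integrable (P:=P) (fun=> M) `|M|) => //.
Qed.

Lemma Rintegral_le_cst (b M : R) : (forall w, `|f w| <= M) ->
  (forall w, f w <= b) -> (\int[P]_w f w)%R <= b.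
Proof.
move=> fM fb; rewrite -[leRHS]Rintegral_probability_cst.
apply: le_Rintegral => //; first exact: (bounded_integrable (P:=P) f M).
exact: (bounded_integrable (P:=P) (fun=> b) `|b|).
Qed.

Lemma Rintegral_ge_cst (a M : R) : (forall w, `|f w| <= M) ->
  (forall w, a <= f w) -> a <= (\int[P]_w f w)%R.
Proof.
move=> fM fa; rewrite -[leLHS]Rintegral_probability_cst.
apply: le_Rintegral => //; last exact: (bounded_integrable (P:=P) f M).
exact: (bounded_integrable (P:=P) (fun=> a) `|a|).
Qed.

End bounded_integral.

(** * Fubini for the first sample and the remaining ones *)

Section head_tail.
Context {R : realType} {dO : measure_display} {Omega : measurableType dO}.
Context (P : probability Omega R).
Context {dZ : measure_display} {Zt : measurableType dZ}.
Context (n : nat) (X : 'I_n.+1 -> Omega -> Zt).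
Hypothesis mX : forall i, measurable_fun setT (X i).
Hypothesis iX : mutually_independent P X.

Let tl := sample n (fun i => X (lift ord0 i)).

Let mtl : measurable_fun setT tl.
Proof. by apply: measurable_sample => i. Qed.

Let mfX : {mfun Omega >-> n.+1.-tuple Zt} :=
  HB.pack (sample n.+1 X) (isMeasurableFun.Build _ _ _ _ _ (measurable_sample n.+1 X mX)).
Let mf0 : {mfun Omega >-> Zt} :=
  HB.pack (X ord0) (isMeasurableFun.Build _ _ _ _ _ (mX ord0)).
Let mft : {mfun Omega >-> n.-tuple Zt} :=
  HB.pack tl (isMeasurableFun.Build _ _ _ _ _ mtl).

Let tcons (z : Zt * n.-tuple Zt) : n.+1.-tuple Zt := [tuple of z.1 :: z.2].

Let mtcons : measurable_fun setT tcons.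
Proof. exact: measurable_cons. Qed.

Let mfc : {mfun (Zt * n.-tuple Zt)%type >-> n.+1.-tuple Zt} :=
  HB.pack tcons (isMeasurableFun.Build _ _ _ _ _ mtcons).

(** Independence enters this section only here. On a box, both measures equal the product of the
    probabilities of the sides, by the product rule for [X] and for its tail; boxes determine the
    measure. *)
Let lawE (C : set (n.+1.-tuple Zt)) : measurable C ->
  distribution P mfX C =
  distribution (distribution P mf0 \x distribution P mft)%E mfc C.
Proof.
apply: measure_tuple_unique => B mB.
transitivity (P (\bigcap_(i in [set: 'I_n.+1]) (X i @^-1` B i))).
  congr (P _); apply/seteqP; split => w /= Bw i => [_|].
    by have := Bw i; rewrite tnth_mktuple.
  by rewrite tnth_mktuple; exact: Bw.
have tcons_box : tcons @^-1` box n.+1 B =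
    B ord0 `*` box n (fun i => B (lift ord0 i)).
  apply/seteqP; split => [[z t] Bzt|[z t] [Bz Bt] i].
    split; first exact: (Bzt ord0).
    by move=> i; have := Bzt (lift ord0 i); rewrite /= tnthS.
  by case: (unliftP ord0 i) => [j ->|-> //]; rewrite /= tnthS; exact: Bt.
rewrite /distribution /pushforward /= tcons_box product_measure1E //; last exact: measurable_box.
rewrite (iX B) // big_ord_recl; congr (_ * _)%E.
rewrite -(mutually_independent_lift n X iX (fun i => B (lift ord0 i))) //.
congr (P _); apply/seteqP; split => w /= Bw i => [|_].
  by rewrite tnth_mktuple; exact: Bw.
by have := Bw i; rewrite tnth_mktuple.
Qed.

Context (f : n.+1.-tuple Zt -> R) (M : R).
Hypothesis mf : measurable_fun setT f.
Hypothesis fM : forall x, `|f x| <= M.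

Let fi dd (T : measurableType dd) (Q : probability T R) (g : T -> n.+1.-tuple Zt) :
  measurable_fun setT g -> Q.-integrable setT (EFin \o (f \o g)).
Proof.
move=> mg; apply: (bounded_integrable _ M); last by move=> w; exact: fM.
exact: measurableT_comp.
Qed.

Let ft (y : n.-tuple Zt) : measurable_fun setT (fun z : Zt => tcons (z, y)).
Proof. exact: (measurable_cons (f:=id) (g:=cst y)). Qed.

Let fz y : P.-integrable setT (EFin \o (fun w => f (tcons (X ord0 w, y)))).
Proof.
apply: (fi _ _ P (fun w => tcons (X ord0 w, y))).
exact: measurableT_comp (ft y) (mX ord0).
Qed.

Let fc (Q : probability (Zt * n.-tuple Zt)%type R) := fi _ _ Q tcons mtcons.

Let GE y : fubini_G (distribution P mf0) (EFin \o (f \o tcons)) y =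
    (\int[P]_w (f (tcons (X ord0 w, y))))%:E.
Proof.
rewrite /fubini_G integral_distribution.
- by rewrite /Rintegral fineK //; exact: integrable_fin_num (fz y).
- exact: (proj2 (measurable_EFinP _ _) (measurableT_comp mf (ft y))).
- exact: (fz y).
Qed.

Lemma measurable_integral_head :
  measurable_fun setT (fun y : n.-tuple Zt => (\int[P]_w (f [tuple of X ord0 w :: y]))%R).
Proof.
apply/measurable_EFinP.
have := measurable_fubini_G (fc (distribution P mf0 \x distribution P mft)%E).
by apply: eq_measurable_fun => y _; exact: GE.
Qed.

(** Inner integration over the first sample with the tail frozen: the order for treating the first
    sample in an induction. *)
Lemma Rintegral_head_tail :
  (\int[P]_w (f (sample n.+1 X w)))%R =
  (\int[P]_w (\int[P]_w' (f [tuple of X ord0 w' :: tl w])))%R.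
Proof.
congr fine.
transitivity (\int[distribution P mfX]_x (f x)%:E)%E.
  rewrite integral_distribution //; first exact/measurable_EFinP.
  exact: (fi _ _ P (sample n.+1 X) (measurable_sample n.+1 X mX)).
rewrite (eq_measure_integral _ (fun C mC _ => lawE C mC)).
rewrite integral_distribution; [|exact/measurable_EFinP|exact: fc].
rewrite -(integral21_prod_meas1 (f:=EFin \o (f \o tcons))); last exact: fc.
rewrite (eq_integral _ _ (fun y _ => GE y)) integral_distribution //.
  exact: (proj2 (measurable_EFinP _ _) measurable_integral_head).
have := bounded_integrable (P:=P) (fun w => (\int[P]_w' (f [tuple of X ord0 w' :: tl w]))%R) M.
apply.
  exact: measurableT_comp measurable_integral_head mtl.
move=> w; apply: Rintegral_norm_le => [|w']; last exact: fM.
exact: measurableT_comp mf (measurableT_comp (ft (tl w)) (mX ord0)).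
Qed.

Let ht (z : Zt) : measurable_fun setT (fun y : n.-tuple Zt => tcons (z, y)).
Proof. exact: (measurable_cons (f:=cst z) (g:=id)). Qed.

Let fzt z : P.-integrable setT (EFin \o (fun w => f (tcons (z, tl w)))).
Proof.
apply: (fi _ _ P (fun w => tcons (z, tl w))).
exact: measurableT_comp (ht z) mtl.
Qed.

Let FE z : fubini_F (distribution P mft) (EFin \o (f \o tcons)) z =
    (\int[P]_w (f (tcons (z, tl w))))%:E.
Proof.
rewrite /fubini_F integral_distribution.
- by rewrite /Rintegral fineK //; exact: integrable_fin_num (fzt z).
- exact: (proj2 (measurable_EFinP _ _) (measurableT_comp mf (ht z))).
- exact: (fzt z).
Qed.

Lemma measurable_integral_tail :
  measurable_fun setT (fun z => (\int[P]_w (f [tuple of z :: tl w]))%R).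
Proof.
apply/measurable_EFinP.
have := measurable_fubini_F (fc (distribution P mf0 \x distribution P mft)%E).
by apply: eq_measurable_fun => y _; exact: FE.
Qed.

(** The opposite order: with the first sample frozen, an induction hypothesis applies to the inner
    integral over the tail. *)
Lemma Rintegral_tail_head :
  (\int[P]_w (f (sample n.+1 X w)))%R =
  (\int[P]_w' (\int[P]_w (f [tuple of X ord0 w' :: tl w])))%R.
Proof.
congr fine.
transitivity (\int[distribution P mfX]_x (f x)%:E)%E.
  rewrite integral_distribution //; first exact/measurable_EFinP.
  exact: (fi _ _ P (sample n.+1 X) (measurable_sample n.+1 X mX)).
rewrite (eq_measure_integral _ (fun C mC _ => lawE C mC)).
rewrite integral_distribution; [|exact/measurable_EFinP|exact: fc].
rewrite -(integral12_prod_meas1 (f:=EFin \o (f \o tcons))); last exact: fc.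
rewrite (eq_integral _ _ (fun y _ => FE y)) integral_distribution //.
  exact: (proj2 (measurable_EFinP _ _) measurable_integral_tail).
have := bounded_integrable (P:=P) (fun w' => (\int[P]_w (f [tuple of X ord0 w' :: tl w]))%R) M.
apply.
  exact: measurableT_comp measurable_integral_tail (mX ord0).
move=> w; apply: Rintegral_norm_le => [|w']; last exact: fM.
exact: measurableT_comp mf (measurableT_comp (ht (X ord0 w)) mtl).
Qed.

End head_tail.

(** * Hoeffding lemma and McDiarmid inequality *)

Lemma le_of_derive_ge0 {R : realType} (f df : R -> R) (u : R) :
  (forall x : R, is_derive x 1 f (df x)) -> (forall x, 0 <= x -> 0 <= df x) ->
  0 <= u -> f 0 <= f u.
Proof.
move=> fd df0 u0.
have [|c /itvP cu fE] := @MVT_segment R f df 0 u u0 (fun x _ => fd x).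
  apply: continuous_subspaceT => x; apply: differentiable_continuous.
  by apply/derivable1_diffP.
by rewrite -subr_ge0 fE mulr_ge0 ?df0 ?subr0 ?cu.
Qed.

(** Taking logarithms, the claim is [g u >= 0]. Both [g] and its derivative [k] vanish at 0, so it
    suffices that [k] has a nonnegative derivative. *)
Lemma bernoulli_mgf_le {R : realType} (p u : R) : 0 <= p <= 1 -> 0 <= u ->
  1 - p + p * expR u <= expR (p * u + u ^+ 2 / 8).
Proof.
move=> /andP[p0 p1] u0.
pose s (x : R) : R := 1 - p + p * expR x.
have s_gt0 x : 0 < s x.
  have := expR_gt0 x; rewrite /s => e0.
  (* Strict positivity comes from [p * expR x], because [1 - p] may vanish; [p = 0] is therefore
     treated apart. *)
  have [->|pn0] := eqVneq p 0; first by rewrite subr0 mul0r addr0.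
  by rewrite ltr_wpDl ?subr_ge0 // mulr_gt0 // lt_neqAle eq_sym pn0.
have ds (x : R) : is_derive x 1 s (p * expR x).
  apply: is_derive_eq.
  by rewrite add0r mul1r.
pose k (x : R) : R := x / 4 + p - p * expR x / s x.
pose g (x : R) : R := x ^+ 2 / 8 + p * x - ln (s x).
(* With [q = p * expR x / s x] this is [1/4 - q (1 - q) = (1 - 2 q)^2 / 4]: a Bernoulli variance is
   at most 1/4, which is the source of the constant 8. *)
have dk (x : R) : is_derive x 1 k (((1 - p) - p * expR x) ^+ 2 / (4 * s x ^+ 2)).
  have sn0 : s x != 0 by rewrite gt_eqF.
  have dV : is_derive x 1 (fun y => (s y)^-1) (- (s x) ^- 2 *: (p * expR x)).
    exact: is_deriveV.
  have de : is_derive x 1 (fun y : R => p * expR y) (p * expR x).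
    by apply: is_derive_eq.
  have dp : is_derive x 1 (fun y : R => y / 4 + p) (1 / 4).
    by apply: is_derive_eq; rewrite scaler0 scaler0 add0r addr0 div1r /GRing.scale /= mulr1.
  have h := is_deriveB dp (is_deriveM de dV).
  apply: (is_derive_eq h).
  by rewrite /GRing.scale /=; move: sn0; rewrite /s => sn0; field.
have dg (x : R) : is_derive x 1 g (k x).
  have dln : is_derive x 1 (@ln R \o s) ((s x)^-1 * (p * expR x)).
    by have dl := is_derive1_ln (s_gt0 x); exact: is_derive1_comp.
  have dpoly : is_derive x 1 (fun y : R => y ^+ 2 / 8 + p * y) (x / 4 + p).
    apply: is_derive_eq.
    by rewrite scaler0 scaler0 add0r /GRing.scale /= !mulr1; field.
  have h := is_deriveB dpoly dln.
  apply: (is_derive_eq h).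
  by rewrite /k [_^-1 * _]mulrC.
have k0 : k 0 = 0 by rewrite /k /s expR0 mul0r mulr1 subrK divr1 add0r subrr.
have k_ge0 x : 0 <= x -> 0 <= k x.
  move=> x0; rewrite -[leLHS]k0; apply: (le_of_derive_ge0 _ _ _ dk) => // y _.
  by rewrite divr_ge0 ?sqr_ge0 // mulr_ge0 // sqr_ge0.
have := le_of_derive_ge0 _ _ _ dg k_ge0 u0.
rewrite /g {1}/s expR0 mulr1 subrK ln1 subr0 mulr0 expr2 mul0r mul0r addr0.
rewrite subr_ge0 => h; rewrite -/(s u) -[leLHS]lnK ?posrE // ler_expR.
by rewrite addrC.
Qed.

Lemma expR_chord {R : realType} (t u : R) : 0 <= t <= 1 ->
  expR (t * u) <= 1 - t + t * expR u.
Proof.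
move=> /andP[t0 t1]; have := convex_expR (Itv01 t0 t1) u 0.
by rewrite !convRE /= mulr0 addr0 expR0 mulr1 addrC.
Qed.

Section mgf.
Context {R : realType} {dO : measure_display} {Omega : measurableType dO}.
Context (P : probability Omega R).

(** Convexity puts [expR] below its chord on [[a, a + D]]. Integrating the chord gives its value at
    the mean, a Bernoulli moment generating function with parameter [(mu - a) / D]. *)
Lemma hoeffding_mgf (f : Omega -> R) (a D : R) : measurable_fun setT f ->
  0 < D -> (forall w, a <= f w <= a + D) ->
  (\int[P]_w expR (f w))%R <= expR ((\int[P]_w f w)%R + D ^+ 2 / 8).
Proof.
move=> mf D0 fa.
have fM w : `|f w| <= `|a| + D.
  have /andP[f1 f2] := fa w; have := ler_norm a; have := ler_norm (- a).
  by rewrite normrN ler_norml => h1 h2; apply/andP; split; lra.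
have ifn := bounded_integrable (P := P) f _ mf fM.
have icst (r : R) := bounded_integrable (P := P) (fun=> r) `|r| (measurable_cst r) (fun=> lexx _).
set mu := (\int[P]_w f w)%R.
have muD : a <= mu <= a + D.
  apply/andP; split.
    by apply: Rintegral_ge_cst fM _ => // w; case/andP: (fa w).
  by apply: Rintegral_le_cst fM _ => // w; case/andP: (fa w).
have Dn0 : D != 0 by rewrite gt_eqF.
(* [be] and [al] are the slope and intercept of the chord; [ale] rewrites it in the barycentric
   coordinate [(x - a) / D]. *)
pose be := expR a * (expR D - 1) / D.
pose al := expR a - be * a.
have ale x : al + be * x = expR a * (1 - (x - a) / D + (x - a) / D * expR D).
  by rewrite /al /be; field.
have t01 x : a <= x <= a + D -> 0 <= (x - a) / D <= 1.
  move=> /andP[ax xD]; rewrite divr_ge0 ?subr_ge0 ?(ltW D0) //=.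
  by rewrite ler_pdivrMr // mul1r lerBlDl.
have xE x : x = a + (x - a) / D * D by rewrite divfK // addrC subrK.
have chord w : expR (f w) <= al + be * f w.
  rewrite ale [in leLHS](xE (f w)) expRD ler_pM2l ?expR_gt0 //.
  exact: expR_chord (t01 _ (fa w)).
apply: (@le_trans _ _ (al + be * mu)).
  have ibe := integrableZl measurableT be ifn.
  rewrite -(RintegralZl _ measurableT ifn) -[X in X + _](Rintegral_probability_cst P al).
  rewrite -RintegralD //; apply: le_Rintegral => //.
    apply: (bounded_integrable _ (expR (`|a| + D))).
      exact: measurableT_comp.
    move=> w; rewrite ger0_norm ?expR_ge0 // ler_expR.
    exact: le_trans (ler_norm _) (fM w).
  exact: (integrableD measurableT (icst al) ibe).
have -> : mu + D ^+ 2 / 8 = a + ((mu - a) / D * D + D ^+ 2 / 8) by field.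
rewrite ale expRD ler_pM2l ?expR_gt0 //.
by apply: bernoulli_mgf_le; [exact: t01|exact: ltW].
Qed.

(** Starting at the infimum of the range, an interval of length [D] contains all values. *)
Lemma hoeffding_mgf_osc (f : Omega -> R) (M D : R) : measurable_fun setT f ->
  0 < D -> (forall w, `|f w| <= M) -> (forall w w', f w - f w' <= D) ->
  (\int[P]_w expR (f w))%R <= expR ((\int[P]_w f w)%R + D ^+ 2 / 8).
Proof.
move=> mf D0 fM fD.
pose a := inf (range f).
have [w0 _] : [set: Omega] !=set0.
  apply/set0P/eqP => O0; have := probability_setT P.
  by rewrite O0 measure0 => /eqP; rewrite eq_sym onee_eq0.
have lb : has_lbound (range f).
  exists (- M) => _ [w _ <-].
  by have := fM w; rewrite ler_norml => /andP[].
apply: (hoeffding_mgf _ a) => // w; apply/andP; split.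
  by apply: ge_inf => //; exists w.
rewrite -lerBlDr; apply: lb_le_inf; first by exists (f w); exists w.
by move=> _ [w' _ <-]; rewrite lerBlDr addrC -lerBlDr; exact: fD.
Qed.

End mgf.

(** Induction on the samples: Hoeffding's lemma integrates out the first one at the cost of
    [D ^+ 2 / 8], and the partial integral [F] inherits bounded differences in the others. *)
Lemma mcdiarmid_mgf {R : realType} {dO : measure_display}
    {Omega : measurableType dO} (P : probability Omega R)
    {dZ : measure_display} {Zt : measurableType dZ} (n : nat)
    (X : 'I_n -> Omega -> Zt) (f : n.-tuple Zt -> R) (M D : R) :
  (forall i, measurable_fun setT (X i)) -> mutually_independent P X ->
  measurable_fun setT f -> (forall x, `|f x| <= M) -> 0 < D ->
  (forall i (x y : n.-tuple Zt), (forall j, j != i -> tnth x j = tnth y j) ->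
     f x - f y <= D) ->
  (\int[P]_w expR (f (sample n X w)))%R <=
  expR ((\int[P]_w f (sample n X w))%R + n%:R * D ^+ 2 / 8).
Proof.
elim: n X f M => [|n IH] X f M mX iX mf fM D0 fD.
  under eq_Rintegral do rewrite [sample _ _ _]tuple0.
  under [in leRHS]eq_Rintegral do rewrite [sample _ _ _]tuple0.
  by rewrite !Rintegral_probability_cst mul0r mul0r addr0.
pose tl := sample n (fun i => X (lift ord0 i)).
pose tcons z (y : n.-tuple Zt) : n.+1.-tuple Zt := [tuple of z :: y].
have mfz y : measurable_fun setT (fun w => f (tcons (X ord0 w) y)).
  apply: measurableT_comp => //.
  exact: (measurable_cons (f:=X ord0) (g:=cst y)).
pose F y := (\int[P]_w f (tcons (X ord0 w) y))%R.
have mF : measurable_fun setT F by exact: (measurable_integral_head P n X mX f M).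
have FM y : `|F y| <= M by exact: Rintegral_norm_le.
have expM x : `|expR (f x)| <= expR M.
  by rewrite ger0_norm ?expR_ge0 // ler_expR; exact: le_trans (ler_norm _) (fM x).
have mexp : measurable_fun setT (expR \o f) by exact: measurableT_comp.
have mtl : measurable_fun setT tl by apply: measurable_sample => i.
rewrite (Rintegral_head_tail P n X mX iX (expR \o f) (expR M)) //.
rewrite (Rintegral_head_tail P n X mX iX f M) //.
have step y : (\int[P]_w (expR \o f) (tcons (X ord0 w) y))%R <=
    expR (F y + D ^+ 2 / 8).
  apply: (hoeffding_mgf_osc _ _ M) => // w w'; apply: (fD ord0) => j.
  by case: (unliftP ord0 j) => [i -> _|->]; rewrite ?eqxx // !tnthS.
(* The cost of the first sample is carried inside the function, so no exponential factor has to be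
   pulled out of the integral. *)
have {}IH := IH (fun i => X (lift ord0 i)) (fun y => F y + D ^+ 2 / 8)
  (M + `|D ^+ 2 / 8|) (fun i => mX _) (mutually_independent_lift n X iX).
have mF8 : measurable_fun setT (fun y => F y + D ^+ 2 / 8).
  exact: measurable_funD.
have FM8 y : `|F y + D ^+ 2 / 8| <= M + `|D ^+ 2 / 8|.
  by apply: le_trans (ler_normD _ _) _; rewrite lerD2r.
apply: (@le_trans _ _ (\int[P]_w expR (F (tl w) + D ^+ 2 / 8))%R); last first.
apply: le_trans (IH mF8 FM8 D0 _) _.
(* Bounded differences of [F]: the difference is an integral of differences of [f] at tuples that
   differ only at [lift ord0 i]. *)
- move=> i x y xy; rewrite opprD addrACA subrr addr0.
  rewrite /F -RintegralB //.
  + apply: (Rintegral_le_cst P _ _ _ (M + M)).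
    * exact: measurable_funB.
    * by move=> w; apply: le_trans (ler_normB _ _) (lerD _ _).
    * move=> w; apply: (fD (lift ord0 i)) => j; case: (unliftP ord0 j) => [k ->|-> //].
      by rewrite !tnthS => ki; apply: xy; apply: contraNneq ki => ->.
  + exact: (bounded_integrable _ M).
  + exact: (bounded_integrable _ M).
- rewrite ler_expR RintegralD //; last 2 first.
  + by apply: (bounded_integrable _ M) => //; exact: measurableT_comp mF mtl.
  + exact: (bounded_integrable _ `|D ^+ 2 / 8|).
  rewrite Rintegral_probability_cst -addrA lerD2l -natr1; lra.
- apply: le_Rintegral => //.
  + apply: (bounded_integrable _ (expR M)).
      exact: measurableT_comp (measurable_integral_head P n X mX (expR \o f) (expR M) mexp expM) mtl.
    move=> w; apply: Rintegral_norm_le => //.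
      by apply: measurableT_comp (mfz _).
    by move=> w'; exact: expM.
  + apply: (bounded_integrable _ (expR (M + `|D ^+ 2 / 8|))).
      by apply: measurableT_comp => //; exact: measurableT_comp mF8 mtl.
    move=> w; rewrite ger0_norm ?expR_ge0 // ler_expR.
    exact: le_trans (ler_norm _) (FM8 _).
  + by move=> w _; exact: step.
Qed.

(** * Rademacher averages of finite classes *)

(** Indexing by ['I_p.+1] makes the class nonempty; the default [b ord0] is one of the values, so
    the result is the true maximum. *)
Definition vmax {R : realType} {p : nat} (b : 'I_p.+1 -> R) : R :=
  \big[Order.max/b ord0]_(h < p.+1) b h.

(* Average of [vmax (b + sum_i s_i a_i)] over all sign vectors [s], defined by
   revealing the signs one at a time so that every property below is proved
   coordinate by coordinate. *)
Fixpoint rad {R : realType} {p n : nat} :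
    ('I_n -> 'I_p.+1 -> R) -> ('I_p.+1 -> R) -> R :=
  match n with
  | 0 => fun _ b => vmax b
  | n'.+1 => fun a b =>
      (rad (fun i => a (lift ord0 i)) (fun h => b h + a ord0 h) +
       rad (fun i => a (lift ord0 i)) (fun h => b h - a ord0 h)) / 2
  end.

Section rademacher.
Context {R : realType} {p : nat}.
Implicit Types (b u v : 'I_p.+1 -> R).

Lemma vmax_ge b h : b h <= vmax b.
Proof. exact: le_bigmax. Qed.

Lemma vmax_le b (x : R) : (forall h, b h <= x) -> vmax b <= x.
Proof. by move=> bx; apply/bigmax_leP; split. Qed.

(** Whichever sign is revealed, the error [e i] moves into the base. This later bounds the effect of
    changing one sample on the Rademacher average. *)
Lemma rad_shift (n : nat) (a a' : 'I_n -> 'I_p.+1 -> R) b b' (e0 : R) (e : 'I_n -> R) :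
  (forall h, b h <= b' h + e0) -> (forall i h, `|a i h - a' i h| <= e i) ->
  rad a b <= rad a' b' + (e0 + \sum_i e i).
Proof.
elim: n a a' b b' e0 e => [|n IH] a a' b b' e0 e bb aa /=.
  rewrite big_ord0 addr0; apply: vmax_le => h.
  by apply: le_trans (bb h) _; rewrite lerD2r vmax_ge.
rewrite big_ord_recl.
have aa' i h : `|a (lift ord0 i) h - a' (lift ord0 i) h| <= e (lift ord0 i) by [].
have h1 := IH _ _ (fun h => b h + a ord0 h) (fun h => b' h + a' ord0 h) (e0 + e ord0) _ _ aa'.
have h2 := IH _ _ (fun h => b h - a ord0 h) (fun h => b' h - a' ord0 h) (e0 + e ord0) _ _ aa'.
suff: (forall h, b h + a ord0 h <= b' h + a' ord0 h + (e0 + e ord0)) /\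
  (forall h, b h - a ord0 h <= b' h - a' ord0 h + (e0 + e ord0)).
  by move=> [/h1 {}h1 /h2 {}h2]; lra.
by split => h; have := bb h; have := aa ord0 h; rewrite ler_norml => /andP[]; lra.
Qed.

(** One step of the Ledoux-Talagrand contraction principle. Both signs are summed because the two
    branches are not comparable separately; the signs of [a] only move the base. *)
Lemma rad_contract_shift (n : nat) (a : 'I_n -> 'I_p.+1 -> R) b u v :
  (forall h h', `|u h - u h'| <= `|v h - v h'|) ->
  rad a (fun h => b h + u h) + rad a (fun h => b h - u h) <=
  rad a (fun h => b h + v h) + rad a (fun h => b h - v h).
Proof.
move=> uv; elim: n a b => [|n IH] a b /=.
  rewrite -lerBrDr; apply: vmax_le => h; rewrite lerBrDr addrC -lerBrDr.
  apply: vmax_le => h'; rewrite lerBrDr.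
  (* On the right, [h] takes the plus branch and [h'] the minus branch if [v h >= v h']; otherwise
     they exchange roles. *)
  have := vmax_ge (fun h => b h + v h) h; have := vmax_ge (fun h => b h + v h) h'.
  have := vmax_ge (fun h => b h - v h) h; have := vmax_ge (fun h => b h - v h) h'.
  have := le_trans (ler_norm _) (uv h h').
  by case: (ger0P (v h - v h')) => _ /=; lra.
have swpp w : (fun h => b h + w h + a ord0 h) = (fun h => b h + a ord0 h + w h).
  by apply/funext => h; ring.
have swpm w : (fun h => b h + w h - a ord0 h) = (fun h => b h - a ord0 h + w h).
  by apply/funext => h; ring.
have swmp w : (fun h => b h - w h + a ord0 h) = (fun h => b h + a ord0 h - w h).
  by apply/funext => h; ring.
have swmm w : (fun h => b h - w h - a ord0 h) = (fun h => b h - a ord0 h - w h).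
  by apply/funext => h; ring.
rewrite (swpp u) (swpp v) (swpm u) (swpm v) (swmp u) (swmp v) (swmm u) (swmm v).
have := IH (fun i => a (lift ord0 i)) (fun h => b h + a ord0 h).
have := IH (fun i => a (lift ord0 i)) (fun h => b h - a ord0 h).
lra.
Qed.

Lemma rad_contract (n : nat) (phi : 'I_n -> R -> R) (c : R)
    (t : 'I_n -> 'I_p.+1 -> R) b : 0 <= c ->
  (forall i x y, `|phi i x - phi i y| <= c * `|x - y|) ->
  rad (fun i h => phi i (t i h)) b <= rad (fun i h => c * t i h) b.
Proof.
move=> c0 phic; elim: n phi t b phic => [|n IH] phi t b phic //=.
(* Intermediate point: the later coordinates are contracted by induction while the first still
   carries [phi ord0]. *)
rewrite ler_pM2r //; apply: (@le_trans _ _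
  (rad (fun i h => c * t (lift ord0 i) h) (fun h => b h + phi ord0 (t ord0 h)) +
   rad (fun i h => c * t (lift ord0 i) h) (fun h => b h - phi ord0 (t ord0 h)))).
  by apply: lerD; exact: (IH (fun i => phi (lift ord0 i)) (fun i => t (lift ord0 i))).
apply: rad_contract_shift => h h'.
by rewrite -mulrBr normrM (ger0_norm c0).
Qed.

Lemma sqrt_add_le (x y : R) : 0 <= x -> 0 <= y ->
  Num.sqrt x + Num.sqrt y <= 2 * Num.sqrt ((x + y) / 2).
Proof.
move=> x0 y0; rewrite -ler_sqr ?nnegrE ?addr_ge0 ?mulr_ge0 ?sqrtr_ge0 //.
rewrite exprMn sqr_sqrtr ?divr_ge0 ?addr_ge0 // sqrrD !sqr_sqrtr //.
have := sqr_ge0 (Num.sqrt x - Num.sqrt y); rewrite sqrrB !sqr_sqrtr //; lra.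
Qed.

Lemma cauchy_schwarz (J : finType) (x y : J -> R) :
  \sum_q x q * y q <= Num.sqrt (\sum_q x q ^+ 2) * Num.sqrt (\sum_q y q ^+ 2).
Proof.
have [x0 y0] : 0 <= \sum_q x q ^+ 2 /\ 0 <= \sum_q y q ^+ 2.
  by split; apply: sumr_ge0 => q _; exact: sqr_ge0.
set X := \sum_q x q ^+ 2; set Y := \sum_q y q ^+ 2.
set S := \sum_q x q * y q.
have S_le : 2 * (Num.sqrt X * Num.sqrt Y) * S <= 2 * (Num.sqrt X * Num.sqrt Y) ^+ 2.
  have : 0 <= \sum_q (x q * Num.sqrt Y - y q * Num.sqrt X) ^+ 2.
    by apply: sumr_ge0 => q _; exact: sqr_ge0.
  have -> : \sum_q (x q * Num.sqrt Y - y q * Num.sqrt X) ^+ 2 =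
      X * Num.sqrt Y ^+ 2 - 2 * (Num.sqrt X * Num.sqrt Y) * S + Y * Num.sqrt X ^+ 2.
    rewrite !mulr_suml mulr_sumr -sumrB -big_split /=.
    by apply: eq_bigr => q _; ring.
  by rewrite exprMn !sqr_sqrtr //; lra.
(* [S_le] can be divided by the product of the norms unless it is zero; in that case one of the
   families vanishes and so does [S]. *)
have [XY0|XY0] := eqVneq (Num.sqrt X * Num.sqrt Y) 0; last first.
  have XY : 0 < Num.sqrt X * Num.sqrt Y.
    by rewrite lt_neqAle eq_sym XY0 mulr_ge0 ?sqrtr_ge0.
  by rewrite -(ler_pM2l XY); move: S_le; lra.
have z_sq (z : J -> R) : Num.sqrt (\sum_q z q ^+ 2) = 0 -> forall q, z q = 0.
  move=> /eqP; rewrite sqrtr_eq0 => z0 q.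
  have : \sum_q z q ^+ 2 == 0.
    by rewrite eq_le z0 sumr_ge0 // => r _; exact: sqr_ge0.
  rewrite psumr_eq0 => [/allP /(_ q)|r _]; last exact: sqr_ge0.
  by rewrite mem_index_enum sqrf_eq0 => /(_ isT) /eqP.
rewrite XY0 /S big1 // => q _; move/eqP: XY0; rewrite mulf_eq0 => /orP[]/eqP/z_sq -> //.
  by rewrite mul0r.
by rewrite mulr0.
Qed.

(** Once all signs are revealed, Cauchy-Schwarz bounds each hypothesis. Averaging over a sign then
    adds the squared norm of one feature vector under the root. The vectors [v] and [v0] accumulate
    the signed features, which makes the induction possible. *)
Lemma rad_linear_le (J J0 : finType) (n : nat)
    (W : 'I_p.+1 -> J -> R) (W0 : 'I_p.+1 -> J0 -> R)
    (y : 'I_n -> J -> R) (y0 : 'I_n -> J0 -> R) (v : J -> R) (v0 : J0 -> R) (K K0 : R) :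
  0 <= K -> 0 <= K0 -> (forall h, \sum_q W h q ^+ 2 <= K ^+ 2) ->
  (forall h, \sum_q W0 h q ^+ 2 <= K0 ^+ 2) ->
  rad (fun i h => \sum_q W h q * y i q + \sum_q W0 h q * y0 i q)
      (fun h => \sum_q W h q * v q + \sum_q W0 h q * v0 q) <=
  K * Num.sqrt (\sum_q v q ^+ 2 + \sum_i \sum_q y i q ^+ 2) +
  K0 * Num.sqrt (\sum_q v0 q ^+ 2 + \sum_i \sum_q y0 i q ^+ 2).
Proof.
move=> K_ge0 K0_ge0 WK WK0; have ss_ge0 (I : finType) (z : I -> R) : 0 <= \sum_q z q ^+ 2.
  by apply: sumr_ge0 => q _; exact: sqr_ge0.
have cs (I : finType) (C : R) (w z : I -> R) :
    0 <= C -> \sum_q w q ^+ 2 <= C ^+ 2 ->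
    \sum_q w q * z q <= C * Num.sqrt (\sum_q z q ^+ 2).
  move=> C_ge0 wC; apply: le_trans (cauchy_schwarz _ _ _) _.
  rewrite ler_wpM2r ?sqrtr_ge0 // -[leRHS](ger0_norm C_ge0) -sqrtr_sqr.
  by rewrite ler_wsqrtr.
(* One sign: concavity of the root followed by the parallelogram law; [S] holds the squared norms of
   the features whose signs have been averaged already. *)
have par (I : finType) (z y' : I -> R) (S C : R) : 0 <= C -> 0 <= S ->
    C * Num.sqrt (\sum_q (z q + y' q) ^+ 2 + S) +
    C * Num.sqrt (\sum_q (z q - y' q) ^+ 2 + S) <=
    C * Num.sqrt (\sum_q z q ^+ 2 + (\sum_q y' q ^+ 2 + S)) * 2.
  move=> C_ge0 S_ge0; rewrite -mulrDr -mulrA ler_wpM2l //.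
  apply: le_trans (sqrt_add_le _ _ _ _) _; rewrite ?addr_ge0 //.
  rewrite mulrC ler_pM2r // ler_wsqrtr // ler_pdivrMr //.
  have -> : \sum_q (z q + y' q) ^+ 2 =
      \sum_q z q ^+ 2 + \sum_q y' q ^+ 2 + 2 * \sum_q z q * y' q.
    rewrite mulr_sumr -!big_split /=; by apply: eq_bigr => q _; ring.
  have -> : \sum_q (z q - y' q) ^+ 2 =
      \sum_q z q ^+ 2 + \sum_q y' q ^+ 2 - 2 * \sum_q z q * y' q.
    rewrite mulr_sumr -sumrN -!big_split /=; by apply: eq_bigr => q _; ring.
  lra.
elim: n y y0 v v0 => [|n IH] y y0 v v0 /=.
  rewrite !big_ord0 !addr0; apply: vmax_le => h.
  by apply: lerD; apply: cs.
(* For [s = 1] and [s = -1] this absorbs the revealed sign into [v] and [v0]. *)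
have lin (s : R) : (fun h => \sum_q W h q * v q + \sum_q W0 h q * v0 q +
    s * (\sum_q W h q * y ord0 q + \sum_q W0 h q * y0 ord0 q)) =
    (fun h => \sum_q W h q * (v q + s * y ord0 q) + \sum_q W0 h q * (v0 q + s * y0 ord0 q)).
  apply/funext => h; rewrite mulrDr !mulr_sumr addrACA -!big_split /=.
  by congr (_ + _); apply: eq_bigr => q _; ring.
have := lin 1; have := lin (-1).
under eq_fun do rewrite mulN1r.
under [X in _ = X]eq_fun do
  (under eq_bigr do rewrite mulN1r; under [X in _ + X]eq_bigr do rewrite mulN1r).
move=> ->.
under eq_fun do rewrite mul1r.
under [X in _ = X]eq_fun do
  (under eq_bigr do rewrite mul1r; under [X in _ + X]eq_bigr do rewrite mul1r).
move=> ->.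
rewrite ler_pdivrMr // mulrDl !big_ord_recl.
apply: le_trans (lerD (IH _ _ _ _) (IH _ _ _ _)) _.
rewrite addrACA; apply: lerD; apply: par => //.
  by apply: sumr_ge0.
by apply: sumr_ge0.
Qed.
End rademacher.

(** * Symmetrization *)

Definition bmeas {R : realType} {d : measure_display} {T : measurableType d}
    (f : T -> R) : Prop :=
  measurable_fun setT f /\ exists M, forall x, `|f x| <= M.

Section bmeas.
#[local] Set Implicit Arguments.
Context {R : realType} {d : measure_display} {T : measurableType d}.
Implicit Types f g : T -> R.

Lemma bmeas_cst (r : R) : bmeas (fun _ : T => r).
Proof. by split; [exact: measurable_cst|exists `|r|]. Qed.

Lemma bmeasD f g : bmeas f -> bmeas g -> bmeas (fun x => f x + g x).
Proof.
move=> [mf [M fM]] [mg [N gN]]; split; first exact: measurable_funD.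
by exists (M + N) => x; apply: le_trans (ler_normD _ _) (lerD _ _).
Qed.

Lemma bmeasZ (r : R) f : bmeas f -> bmeas (fun x => r * f x).
Proof.
move=> [mf [M fM]]; split; first exact: measurable_funM.
by exists (`|r| * M) => x; rewrite normrM ler_wpM2l.
Qed.

Lemma bmeasB f g : bmeas f -> bmeas g -> bmeas (fun x => f x - g x).
Proof.
move=> bf /(bmeasZ (-1)) bg; have := bmeasD bf bg.
by under eq_fun do rewrite mulN1r.
Qed.

Lemma bmeas_max f g : bmeas f -> bmeas g -> bmeas (fun x => Order.max (f x) (g x)).
Proof.
move=> [mf [M fM]] [mg [N gN]]; split; first exact: measurable_maxr.
exists (Order.max M N) => x; rewrite le_max.
by case: (leP (f x) (g x)) => _; rewrite ?fM ?gN ?orbT.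
Qed.

Lemma bmeas_sum (I : Type) (s : seq I) (F : I -> T -> R) :
  (forall i, bmeas (F i)) -> bmeas (fun x => \sum_(i <- s) F i x).
Proof.
move=> bF; elim: s => [|i s IH].
  by under eq_fun do rewrite big_nil; exact: bmeas_cst.
by under eq_fun do rewrite big_cons; exact: bmeasD.
Qed.

Lemma bmeas_vmax (p : nat) (b : 'I_p.+1 -> T -> R) :
  (forall h, bmeas (b h)) -> bmeas (fun x => vmax (b ^~ x)).
Proof.
move=> bb; rewrite /vmax; elim: (index_enum _) => [|i s IH].
  by under eq_fun do rewrite big_nil; exact: bb.
by under eq_fun do rewrite big_cons; exact: bmeas_max.
Qed.

Lemma bmeas_rad (p n : nat) (a : 'I_n -> 'I_p.+1 -> T -> R) (b : 'I_p.+1 -> T -> R) :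
  (forall i h, bmeas (a i h)) -> (forall h, bmeas (b h)) ->
  bmeas (fun x => rad (fun i h => a i h x) (fun h => b h x)).
Proof.
elim: n a b => [|n IH] a b ba bb /=; first exact: bmeas_vmax.
under eq_fun do rewrite mulrC.
apply/bmeasZ/bmeasD; apply: (IH (fun i => a (lift ord0 i))) => // h.
  exact: bmeasD.
exact: bmeasB.
Qed.

End bmeas.

Lemma bmeas_comp {R : realType} {d d' : measure_display} {T : measurableType d}
    {T' : measurableType d'} {f : T' -> R} {g : T -> T'} :
  bmeas f -> measurable_fun setT g -> bmeas (fun x => f (g x)).
Proof.
move=> [mf [M fM]] mg; split; first exact: measurableT_comp.
by exists M => x.
Qed.

Section integral_bmeas.
#[local] Set Implicit Arguments.
Context {R : realType} {dO : measure_display} {Omega : measurableType dO}.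
Context (P : probability Omega R).
Implicit Types f g : Omega -> R.

Lemma bmeas_integrable f : bmeas f -> P.-integrable setT (EFin \o f).
Proof. by move=> [mf [M fM]]; exact: (bounded_integrable _ M). Qed.

Lemma le_Rintegral_bmeas f g : bmeas f -> bmeas g -> (forall w, f w <= g w) ->
  (\int[P]_w f w)%R <= (\int[P]_w g w)%R.
Proof.
by move=> bf bg fg; apply: le_Rintegral => //; exact: bmeas_integrable.
Qed.

Lemma Rintegral_half f g : bmeas f -> bmeas g ->
  (\int[P]_w ((f w + g w) / 2))%R = ((\int[P]_w f w)%R + (\int[P]_w g w)%R) / 2.
Proof.
move=> bf bg; rewrite RintegralZr //; last exact/bmeas_integrable/bmeasD.
by rewrite RintegralD //; exact: bmeas_integrable.
Qed.

Lemma jensen_vmax (p : nat) (c : 'I_p.+1 -> R) (g : 'I_p.+1 -> Omega -> R) :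
  (forall h, bmeas (g h)) ->
  vmax (fun h => c h + 2 * (\int[P]_w g h w)%R) <=
  (\int[P]_w vmax (fun h => c h + 2 * g h w))%R.
Proof.
move=> bg; apply: vmax_le => h.
have bcg h' : bmeas (fun w => c h' + 2 * g h' w).
  by apply: bmeasD; [exact: bmeas_cst|exact: bmeasZ].
rewrite -(Rintegral_probability_cst P (c h)) -RintegralZl //; last exact: bmeas_integrable.
rewrite -RintegralD //; last 2 first.
- exact/bmeas_integrable/bmeas_cst.
- exact/bmeas_integrable/bmeasZ.
apply: le_Rintegral_bmeas => // [|w].
  exact: bmeas_vmax.
exact: (vmax_ge (fun h => c h + 2 * g h w)).
Qed.

(* Jensen makes an independent ghost sample unnecessary: [E g - g] is the
   midpoint of [2 E g] and [- 2 g]. *)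
Lemma symmetrize_one (p : nat) (c : 'I_p.+1 -> R) (g : 'I_p.+1 -> Omega -> R) :
  (forall h, bmeas (g h)) ->
  (\int[P]_w vmax (fun h => c h + ((\int[P]_w' g h w')%R - g h w)))%R <=
  (\int[P]_w ((vmax (fun h => c h + 2 * g h w) +
               vmax (fun h => c h - 2 * g h w)) / 2))%R.
Proof.
move=> bg.
have b1 h : bmeas (fun w => c h + 2 * g h w).
  by apply: bmeasD; [exact: bmeas_cst|exact: bmeasZ].
have b2 h : bmeas (fun w => c h - 2 * g h w).
  by apply: bmeasB; [exact: bmeas_cst|exact: bmeasZ].
have b3 h : bmeas (fun w => c h + ((\int[P]_w' g h w')%R - g h w)).
  by apply: bmeasD; [exact: bmeas_cst|apply: bmeasB => //; exact: bmeas_cst].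
set C := vmax (fun h => c h + 2 * (\int[P]_w g h w)%R).
apply: (@le_trans _ _ (\int[P]_w ((C + vmax (fun h => c h - 2 * g h w)) / 2))%R).
  apply: le_Rintegral_bmeas; first exact: bmeas_vmax.
    under eq_fun do rewrite mulrC.
    by apply/bmeasZ/bmeasD; [exact: bmeas_cst|exact: bmeas_vmax].
  move=> w; apply: vmax_le => h.
  have := vmax_ge (fun h => c h + 2 * (\int[P]_w g h w)%R) h.
  have := vmax_ge (fun h => c h - 2 * g h w) h.
  rewrite -/C; lra.
rewrite !Rintegral_half; try exact: bmeas_vmax; last exact: bmeas_cst.
rewrite ler_pM2r // lerD2r Rintegral_probability_cst.
exact: jensen_vmax.
Qed.

End integral_bmeas.

Section symmetrization.
#[local] Set Implicit Arguments.
Context {R : realType} {dO : measure_display} {Omega : measurableType dO}.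
Context (P : probability Omega R).
Context {dZ : measure_display} {Zt : measurableType dZ} {p : nat}.

(** Samples are symmetrized one at a time: first [symmetrize_one] with the tail frozen, then the
    induction hypothesis with the first sample frozen, on the two bases [b + 2 g] and [b - 2 g] that
    define [rad]. *)
Lemma symmetrization (n : nat) (X : 'I_n -> Omega -> Zt)
    (g : 'I_n -> 'I_p.+1 -> Zt -> R) (b : 'I_p.+1 -> R) :
  (forall i, measurable_fun setT (X i)) -> mutually_independent P X ->
  (forall i h, bmeas (g i h)) ->
  (\int[P]_w vmax (fun h => b h +
     \sum_i ((\int[P]_w' g i h (X i w'))%R - g i h (X i w))))%R <=
  (\int[P]_w rad (fun i h => 2 * g i h (X i w)) b)%R.
Proof.
elim: n X g b => [|n IH] X g b mX iX bg.
  rewrite le_eqVlt; apply/orP; left; apply/eqP.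
  by under eq_Rintegral do under eq_fun do rewrite big_ord0 addr0.
pose m i h := (\int[P]_w g i h (X i w))%R.
pose X' (i : 'I_n) := X (lift ord0 i).
pose phi b' (z : 'I_n -> Zt) := vmax (fun h => b' h +
  \sum_i (m (lift ord0 i) h - g (lift ord0 i) h (z i))).
have bphi dd (T : measurableType dd) (b' : 'I_p.+1 -> T -> R) (Y : 'I_n -> T -> Zt) :
    (forall h, bmeas (b' h)) -> (forall i, measurable_fun setT (Y i)) ->
    bmeas (fun w => phi (b' ^~ w) (Y ^~ w)).
  move=> bb' mY; apply: bmeas_vmax => h; apply: bmeasD => //.
  apply: bmeas_sum => i; apply: bmeasB; first exact: bmeas_cst.
  exact: bmeas_comp.
pose f (x : n.+1.-tuple Zt) := phi (fun h => b h + (m ord0 h - g ord0 h (tnth x ord0)))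
  (fun i => tnth x (lift ord0 i)).
(* The intermediate functional: the first sample is symmetrized, the others are still centred. *)
pose hh (x : n.+1.-tuple Zt) :=
  (phi (fun h => b h + 2 * g ord0 h (tnth x ord0)) (fun i => tnth x (lift ord0 i)) +
   phi (fun h => b h - 2 * g ord0 h (tnth x ord0)) (fun i => tnth x (lift ord0 i))) / 2.
pose k (x : n.+1.-tuple Zt) := rad (fun i h => 2 * g i h (tnth x i)) b.
have bt i h : bmeas (fun x : n.+1.-tuple Zt => g i h (tnth x i)).
  by apply: bmeas_comp => //; exact: measurable_tnth.
have mt (i : 'I_n) : measurable_fun setT (fun x : n.+1.-tuple Zt => tnth x (lift ord0 i)).
  exact: measurable_tnth.
have bf : bmeas f.
  apply: (bphi _ _ (fun h x => b h + (m ord0 h - g ord0 h (tnth x ord0)))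
    (fun i x => tnth x (lift ord0 i))) => // h.
  by apply: bmeasD; [exact: bmeas_cst|apply: bmeasB => //; exact: bmeas_cst].
have bhh : bmeas hh.
  rewrite /hh; under eq_fun do rewrite mulrC; apply/bmeasZ/bmeasD.
    apply: (bphi _ _ (fun h x => b h + 2 * g ord0 h (tnth x ord0))
      (fun i x => tnth x (lift ord0 i))) => // h.
    by apply: bmeasD; [exact: bmeas_cst|exact: bmeasZ].
  apply: (bphi _ _ (fun h x => b h - 2 * g ord0 h (tnth x ord0))
    (fun i x => tnth x (lift ord0 i))) => // h.
  by apply: bmeasB; [exact: bmeas_cst|exact: bmeasZ].
have bk : bmeas k.
  apply: (bmeas_rad (fun i h x => 2 * g i h (tnth x i)) (fun h _ => b h)) => // *.
    exact: bmeasZ.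
  exact: bmeas_cst.
have lhsE : (\int[P]_w vmax (fun h => b h +
     \sum_i (m i h - g i h (X i w))))%R = (\int[P]_w f (sample n.+1 X w))%R.
  apply: eq_Rintegral => w _; congr vmax; apply/funext => h.
  rewrite big_ord_recl addrA tnth_mktuple; congr (_ + _).
  by apply: eq_bigr => i _; rewrite tnth_mktuple.
have rhsE : (\int[P]_w rad (fun i h => 2 * g i h (X i w)) b)%R =
    (\int[P]_w k (sample n.+1 X w))%R.
  apply: eq_Rintegral => w _; congr rad; apply/funext => i; apply/funext => h.
  by rewrite tnth_mktuple.
rewrite lhsE rhsE.
have [[mf [M fM]] [mhh [N hN]]] := (bf, bhh); have [mk [L kL]] := bk.
have mtl : measurable_fun setT (sample n X') by apply: measurable_sample => i; exact: mX.
have mX' i : measurable_fun setT (X' i) by exact: mX.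
rewrite (Rintegral_head_tail P n X mX iX f M) //.
have bin (u : n.+1.-tuple Zt -> R) (y : n.-tuple Zt) : bmeas u ->
    bmeas (fun w => u [tuple of X ord0 w :: y]).
  by move=> bu; apply: bmeas_comp => //; exact: (measurable_cons (f:=X ord0) (g:=cst y)).
have bin' (u : n.+1.-tuple Zt -> R) z : bmeas u ->
    bmeas (fun w => u [tuple of z :: sample n X' w]).
  by move=> bu; apply: bmeas_comp => //; exact: (measurable_cons (f:=cst z) (g:=sample n X')).
have bint (u : n.+1.-tuple Zt -> R) : bmeas u ->
    bmeas (fun w => \int[P]_w' u [tuple of X ord0 w' :: sample n X' w])%R.
  move=> bu; have [mu [K uK]] := bu; split.
    exact: measurableT_comp (measurable_integral_head P n X mX u K mu uK) mtl.
  by exists K => w; apply: Rintegral_norm_le => //; case: (bin u (sample n X' w) bu).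
have bint' (u : n.+1.-tuple Zt -> R) : bmeas u ->
    bmeas (fun w => \int[P]_w' u [tuple of X ord0 w :: sample n X' w'])%R.
  move=> bu; have [mu [K uK]] := bu; split.
    exact: measurableT_comp (measurable_integral_tail P n X mX u K mu uK) (mX ord0).
  by exists K => w; apply: Rintegral_norm_le => //; case: (bin' u (X ord0 w) bu).
apply: (@le_trans _ _ (\int[P]_w (\int[P]_w' hh [tuple of X ord0 w' :: sample n X' w]))%R).
  apply: le_Rintegral_bmeas; [exact: bint|exact: bint|move=> w].
  have bg0 h : bmeas (fun w => g ord0 h (X ord0 w)) by exact: bmeas_comp.
  pose c h := b h + \sum_(i < n) (m (lift ord0 i) h - g (lift ord0 i) h (X' i w)).
  have := symmetrize_one P c _ bg0; congr (_ <= _); apply: eq_Rintegral => w' _.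
    congr vmax; apply/funext => h; rewrite /c addrAC tnth0; congr (_ + _ + _).
    by apply: eq_bigr => i _; rewrite tnthS tnth_mktuple.
  congr ((_ + _) / _); congr vmax; apply/funext => h; rewrite /c addrAC tnth0;
    congr (_ + _ + _); by apply: eq_bigr => i _; rewrite tnthS tnth_mktuple.
(* The order of integration is exchanged so that the induction hypothesis applies for each value of
   the first sample. *)
rewrite -(Rintegral_head_tail P n X mX iX hh N) // (Rintegral_tail_head P n X mX iX hh N) //.
rewrite (Rintegral_tail_head P n X mX iX k L) //.
apply: le_Rintegral_bmeas; [exact: bint'|exact: bint'|move=> w].
have e1 (s : 'I_p.+1 -> R) w' :
    phi s (fun i => tnth [tuple of X ord0 w :: sample n X' w'] (lift ord0 i)) =
    phi s (fun i => X' i w').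
  by congr phi; apply/funext => i; rewrite tnthS tnth_mktuple.
have e2 (s : 'I_p.+1 -> R) w' :
    rad (fun i h => 2 * g (lift ord0 i) h
      (tnth [tuple of X ord0 w :: sample n X' w'] (lift ord0 i))) s =
    rad (fun i h => 2 * g (lift ord0 i) h (X' i w')) s.
  by congr rad; apply/funext => i; apply/funext => h; rewrite tnthS tnth_mktuple.
under eq_Rintegral do rewrite /hh !e1 tnth0.
under [leRHS]eq_Rintegral do rewrite /k /= !e2 tnth0.
have bphi' (s : 'I_p.+1 -> R) : bmeas (fun w' => phi s (fun i => X' i w')).
  by apply: (bphi _ _ (fun h _ => s h) X') => // h; exact: bmeas_cst.
have brad (s : 'I_p.+1 -> R) : bmeas (fun w' => rad (fun i h => 2 * g (lift ord0 i) h (X' i w')) s).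
  apply: (bmeas_rad (fun i h w' => 2 * g (lift ord0 i) h (X' i w')) (fun h _ => s h)) => *.
    by apply: bmeasZ; exact: bmeas_comp.
  exact: bmeas_cst.
rewrite !Rintegral_half // ler_pM2r //.
have iX' := mutually_independent_lift n X iX.
by apply: lerD; exact: (IH X' (fun i => g (lift ord0 i))).
Qed.
End symmetrization.

(** * Uniform deviation over a finite class *)

Lemma chernoff_bmeas {R : realType} {dO : measure_display} {Omega : measurableType dO}
  (P : probability Omega R) (f : Omega -> R) (r a : R) : bmeas f -> 0 < r ->
  (P [set w | (a <= f w)%R] <= ((\int[P]_w expR (r * f w))%R * expR (- (r * a)))%:E)%E.
Proof.
move=> bf r0; have [mf [M fM]] := bf.
pose X : {RV P >-> R} := HB.pack f (isMeasurableFun.Build _ _ _ _ _ mf).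
have := chernoff X a r0; rewrite /mmt_gen_fun unlock.
rewrite /Rintegral EFinM fineK //.
  have -> // : (\int[P]_w (expR (r * f w))%:E)%E = (\int[P]_w ((expR \o r \o* X) w)%:E)%E.
  by apply: eq_integral => w _; rewrite /= mulrC.
apply: integrable_fin_num => //; apply: (bounded_integrable _ (expR (r * M))).
  by apply: measurableT_comp => //; exact: measurable_funM.
move=> w; rewrite ger0_norm ?expR_ge0 // ler_expR ler_pM2l //.
exact: le_trans (ler_norm _) (fM w).
Qed.

Section deviation.
#[local] Set Implicit Arguments.
Context {R : realType} {dO : measure_display} {Omega : measurableType dO}.
Context (P : probability Omega R).
Context {dZ : measure_display} {Zt : measurableType dZ} {p : nat}.

Lemma uniform_deviation (n : nat) (X : 'I_n -> Omega -> Zt)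
    (g : 'I_n -> 'I_p.+1 -> Zt -> R) (B delta : R) :
  (0 < n)%N -> 0 < B -> 0 < delta < 1 ->
  (forall i, measurable_fun setT (X i)) -> mutually_independent P X ->
  (forall i h, measurable_fun setT (g i h)) -> (forall i h z, 0 <= g i h z <= B) ->
  exists E : set Omega, [/\ measurable E, ((1 - delta)%:E <= P E)%E &
    forall w, E w -> forall h,
      \sum_i ((\int[P]_w' g i h (X i w'))%R - g i h (X i w)) <=
      rad (fun i h => 2 * g i h (X i w)) (fun=> 0) +
      3 * B * Num.sqrt (n%:R * ln (2 / delta) / 2)].
Proof.
move=> n0 B0 /andP[d0 d1] mX iX mg gB.
have bg i h : bmeas (g i h).
  split=> //; exists B => z; have /andP[g0 g1] := gB i h z.
  by rewrite ger0_norm.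
pose m i h := (\int[P]_w' g i h (X i w'))%R.
(* The summand 0 is the base to which [symmetrization] is applied. *)
pose Phi (x : n.-tuple Zt) := vmax (fun h => 0 + \sum_i (m i h - g i h (tnth x i))).
pose Rad (x : n.-tuple Zt) := rad (fun i h => 2 * g i h (tnth x i)) (fun=> 0).
pose Psi x := Phi x - Rad x.
have bt i h : bmeas (fun x : n.-tuple Zt => g i h (tnth x i)).
  by apply: bmeas_comp => //; exact: measurable_tnth.
have bPhi : bmeas Phi.
  apply: bmeas_vmax => h; apply: bmeasD; first exact: bmeas_cst.
  by apply: bmeas_sum => i; apply: bmeasB => //; exact: bmeas_cst.
have bRad : bmeas Rad.
  apply: (bmeas_rad (fun i h x => 2 * g i h (tnth x i)) (fun h _ => 0)) => *.
    exact: bmeasZ.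
  exact: bmeas_cst.
have bPsi : bmeas Psi by exact: bmeasB.
have ms : measurable_fun setT (sample n X) by exact: measurable_sample.
have EPsi : (\int[P]_w Psi (sample n X w))%R <= 0.
  rewrite RintegralB //; try by apply: bmeas_integrable; exact: bmeas_comp.
  rewrite subr_le0; have := symmetrization _ (fun=> 0) mX iX bg.
  congr (_ <= _); apply: eq_Rintegral => w _.
    by congr vmax; apply/funext => h; congr (_ + _); apply: eq_bigr => i _; rewrite tnth_mktuple.
  by congr rad; apply/funext => i; apply/funext => h; rewrite tnth_mktuple.
have gd i h (z z' : Zt) : `|g i h z - g i h z'| <= B.
  have /andP[? ?] := gB i h z; have /andP[? ?] := gB i h z'.
  by rewrite ler_norml; apply/andP; split; lra.
have dPsi i (x y : n.-tuple Zt) : (forall j, j != i -> tnth x j = tnth y j) ->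
    Psi x - Psi y <= 3 * B.
  move=> xy.
  have hPhi : Phi x <= Phi y + B.
    apply: vmax_le => h; rewrite add0r.
    have := vmax_ge (fun h => 0 + \sum_i (m i h - g i h (tnth y i))) h.
    rewrite -/(Phi y) add0r; suff : \sum_i (m i h - g i h (tnth x i)) <=
      \sum_i (m i h - g i h (tnth y i)) + B by lra.
    rewrite (bigD1 i) //= [in leRHS](bigD1 i) //=.
    rewrite (eq_bigr (fun j => m j h - g j h (tnth y j))) => [|j ji]; last by rewrite xy.
    have := gd i h (tnth x i) (tnth y i); rewrite ler_norml => /andP[? ?]; lra.
  have hRad : Rad y <= Rad x + 2 * B.
    have := @rad_shift R p n (fun i h => 2 * g i h (tnth y i))
      (fun i h => 2 * g i h (tnth x i)) (fun=> 0) (fun=> 0) 0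
      (fun j => if j == i then 2 * B else 0).
    rewrite -big_mkcond big_pred1_eq !add0r => H; apply: H => // j h.
    case: eqP => [->|/eqP ji]; last by rewrite xy // subrr normr0.
    by rewrite -mulrBr normrM ger0_norm // ler_pM2l.
  rewrite /Psi; lra.
set eps := 3 * B * Num.sqrt (n%:R * ln (2 / delta) / 2).
have nR : 0 < n%:R :> R by rewrite ltr0n.
have ln0 : 0 < ln (2 / delta).
  by rewrite ln_gt0 // ltr_pdivlMr // mul1r; lra.
have eps0 : 0 < eps.
  by rewrite mulr_gt0 ?mulr_gt0 // sqrtr_gt0 divr_gt0 ?mulr_gt0.
(* The minimizer of the Chernoff exponent [n (3 B lam)^2 / 8 - lam eps]; the minimum is
   [- 2 eps^2 / (9 B^2 n) = - ln (2 / delta)]. *)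
pose lam := 4 * eps / (9 * B ^+ 2 * n%:R).
have B2n : 0 < 9 * B ^+ 2 * n%:R by rewrite !mulr_gt0 ?exprn_gt0.
have lam0 : 0 < lam by rewrite divr_gt0 // mulr_gt0.
have mgf : (\int[P]_w expR (lam * Psi (sample n X w)))%R <=
    expR (n%:R * (lam * (3 * B)) ^+ 2 / 8).
  have [ml [M lM]] := bmeasZ lam bPsi.
  apply: le_trans (mcdiarmid_mgf P n X (fun x => lam * Psi x) M (lam * (3 * B)) mX iX ml lM _ _) _.
  - by rewrite mulr_gt0 // mulr_gt0.
  - by move=> i x y xy; rewrite -mulrBr ler_pM2l //; exact: dPsi xy.
  rewrite ler_expR gerDr RintegralZl //; last exact/bmeas_integrable/bmeas_comp.
  by rewrite pmulr_rle0.
have bPs : bmeas (fun w => Psi (sample n X w)) by exact: bmeas_comp.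
pose F := [set w | eps <= Psi (sample n X w)].
have mF : measurable F.
  by rewrite -[F]setTI; apply: measurable_fun_le => //; case: bPs.
have PF : (P F <= delta%:E)%E.
  apply: le_trans (chernoff_bmeas P _ _ eps bPs lam0) _; rewrite lee_fin.
  apply: (@le_trans _ _ (expR (n%:R * (lam * (3 * B)) ^+ 2 / 8) * expR (- (lam * eps)))).
    by rewrite ler_pM2r ?expR_gt0.
  rewrite -expRD.
  have -> : n%:R * (lam * (3 * B)) ^+ 2 / 8 + - (lam * eps) =
      - (2 * eps ^+ 2 / (9 * B ^+ 2 * n%:R)).
    by rewrite /lam; field; rewrite !gt_eqF.
  have -> : 2 * eps ^+ 2 / (9 * B ^+ 2 * n%:R) = ln (2 / delta).
    rewrite /eps exprMn sqr_sqrtr; last by rewrite divr_ge0 ?mulr_ge0 ?ltW.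
    by field; rewrite !gt_eqF.
  rewrite expRN lnK ?posrE ?divr_gt0 // invf_div; lra.
exists (~` F); split.
- exact: measurableC.
- rewrite probability_setC // EFinB; apply: leeB => //.
- move=> w /= /negP; rewrite -ltNge => Pw h.
  have le_Phi : \sum_i (m i h - g i h (X i w)) <= Phi (sample n X w).
    apply: le_trans (vmax_ge _ h); rewrite add0r le_eqVlt; apply/orP; left.
    by apply/eqP; apply: eq_bigr => i _; rewrite tnth_mktuple.
  have RadE : Rad (sample n X w) = rad (fun i h => 2 * g i h (X i w)) (fun=> 0).
    by congr rad; apply/funext => i; apply/funext => k; rewrite tnth_mktuple.
  by move: Pw; rewrite /Psi RadE /m in le_Phi *; lra.
Qed.

End deviation.

(** * Events, laws and limits *)

Section probability_helpers.
#[local] Set Implicit Arguments.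
Context {R : realType} {dO : measure_display} {Omega : measurableType dO}.
Context (P : probability Omega R).

(** The limit superior of the events: the unions [G q] decrease and each has probability at least
    [r], so continuity from above applies. An intersection of the [E p] could lose probability at
    every stage. *)
Lemma often_event (r : R) (E : nat -> set Omega) :
  (forall p, measurable (E p)) -> (forall p, (r%:E <= P (E p))%E) ->
  exists F : set Omega, [/\ measurable F, (r%:E <= P F)%E &
    forall w, F w -> forall q, exists2 p, (q <= p)%N & E p w].
Proof.
move=> mE rE; pose G q := \bigcup_(p in [set p | (q <= p)%N]) E p.
have mG q : measurable (G q) by apply: bigcup_measurable => p _.
have mF : measurable (\bigcap_q G q) by apply: bigcap_measurable => // q _.
exists (\bigcap_q G q); split => //.
  have niG : nonincreasing_seq G.
    by move=> q q' qq'; apply/subsetPset => w [p /= q'p Ep];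
      exists p => //=; exact: leq_trans q'p.
  have G0 : (P (G 0%N) < +oo)%E by rewrite ltey_eq fin_num_measure.
  have cG := nonincreasing_cvg_mu (mu:=P) G0 mG mF niG.
  rewrite -(cvg_lim _ cG) //; apply: lime_ge; first by apply/cvg_ex; eexists; exact: cG.
  apply: nearW => q; apply: le_trans (rE q) _ => /=.
  by apply: le_measure; rewrite ?inE //; move=> w Ew; exists q => /=.
by move=> w Fw q; have [p qp Ep] := Fw q I; exists p.
Qed.

Lemma mutually_independent_enum {dZ : measure_display} {Zt : measurableType dZ}
    (J : finType) (Z : J -> Omega -> Zt) :
  mutually_independent P Z ->
  mutually_independent P (fun k : 'I_#|J| => Z (enum_val k)).
Proof.
move=> iZ B mB; have := iZ (fun i => B (enum_rank i)) (fun i => mB _).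
rewrite (_ : \bigcap_(i in [set: J]) _ =
    \bigcap_(k in [set: 'I_#|J|]) (Z (enum_val k) @^-1` B k)).
  move=> ->; rewrite (reindex (fun k : 'I_#|J| => enum_val k)); last exact/onW_bij/enum_val_bij.
  by apply: eq_bigr => k _; rewrite enum_valK.
apply/seteqP; split => w Bw k _.
  by have := Bw (enum_val k) I; rewrite /= enum_valK.
by have := Bw (enum_rank k) I; rewrite /= enum_rankK.
Qed.

Lemma Rintegral_law {dZ : measure_display} {Zt : measurableType dZ}
    (mu : probability Zt R) (X : Omega -> Zt) (f : Zt -> R) :
  measurable_fun setT X -> (forall E, measurable E -> P (X @^-1` E) = mu E) ->
  bmeas f -> (\int[P]_w f (X w))%R = (\int[mu]_z f z)%R.
Proof.
move=> mX Xmu bf.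
pose Y : {mfun Omega >-> Zt} := HB.pack X (isMeasurableFun.Build _ _ _ _ _ mX).
congr fine; transitivity (\int[distribution P Y]_z (f z)%:E)%E; last first.
  by apply: eq_measure_integral => E mE _; exact: Xmu.
rewrite integral_distribution //; first by apply/measurable_EFinP; case: bf.
exact: (bmeas_integrable P (bmeas_comp bf mX)).
Qed.

Lemma Rintegral_bounded_cvg (f : nat -> Omega -> R) (g : Omega -> R) (B : R) :
  (forall j, measurable_fun setT (f j)) -> measurable_fun setT g ->
  (forall j w, `|f j w| <= B) -> (forall w, f ^~ w @ \oo --> g w) ->
  (fun j => \int[P]_w f j w)%R @ \oo --> (\int[P]_w g w)%R.
Proof.
move=> mf mg fB fg.
have [] := @dominated_convergence _ _ _ P setT measurableT
  (fun j => EFin \o f j) (EFin \o g) (fun=> B%:E).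
- by move=> j; exact/measurable_EFinP.
- exact/measurable_EFinP.
- by apply: aeW => w _ /=; apply: cvg_EFin; [exact: nearW|exact: fg].
- exact: (bmeas_integrable _ (bmeas_cst B)).
- by apply: aeW => w j _ /=; rewrite lee_fin.
move=> ig _ h; apply: fine_cvg; rewrite fineK //.
exact: integrable_fin_num ig.
Qed.

End probability_helpers.

Lemma sum_samples {V : nmodType} (T : nat) (m : 'I_T -> nat)
    (F : {t : 'I_T & 'I_(m t)} -> V) :
  \sum_(k < #|{: {t : 'I_T & 'I_(m t)}}|) F (enum_val k) =
  \sum_(t < T) \sum_(i < m t) F (Tagged (fun t => 'I_(m t)) i).
Proof.
rewrite (sig_big_dep _ _ (fun t i => F (Tagged (fun t => 'I_(m t)) i))) /=.
rewrite [RHS](reindex (fun k : 'I_#|{: {t : 'I_T & 'I_(m t)}}| => enum_val k)) /=.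
  by apply: eq_bigr => k _; case: (enum_val k).
exact/onW_bij/enum_val_bij.
Qed.

(** * The linear class and its rational points *)

Section linear_algebra.
#[local] Set Implicit Arguments.
Context {R : realType} {d T : nat}.
Implicit Types (A : 'M[R]_(d, T)) (u v a : 'cV[R]_d) (U : 'M[R]_d).

(** Squared Frobenius norm. The single index over pairs matches a weight family of
    [rad_linear_le]. *)
Definition frob A : R := \sum_(q : 'I_d * 'I_T) A q.1 q.2 ^+ 2.

Lemma dotv_mx u v : dotv u v = (u^T *m v) 0 0.
Proof. by rewrite mxE; apply: eq_bigr => i _; rewrite mxE. Qed.

Lemma dotv_mulmx U u v : dotv u (U^T *m v) = dotv (U *m u) v.
Proof. by rewrite !dotv_mx trmx_mul mulmxA. Qed.

Lemma sqnorm_isometry U u : U^T *m U = 1%:M -> sqnorm (U *m u) = sqnorm u.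
Proof. by move=> UU; rewrite /sqnorm -dotv_mulmx mulmxA UU mul1mx. Qed.

Lemma frob_col A : frob A = \sum_(j < T) sqnorm (col j A).
Proof.
rewrite /frob -(pair_bigA _ (fun i j => A i j ^+ 2)) /= exchange_big /=.
by apply: eq_bigr => j _; apply: eq_bigr => i _; rewrite mxE expr2.
Qed.

Lemma col_mulmx U A (j : 'I_T) : col j (U *m A) = U *m col j A.
Proof.
by apply/colP => i; rewrite !mxE; apply: eq_bigr => k _; rewrite mxE.
Qed.

Lemma frob_isometry U A : U^T *m U = 1%:M -> frob (U *m A) = frob A.
Proof.
move=> UU; rewrite !frob_col; apply: eq_bigr => j _.
by rewrite -(sqnorm_isometry (col j A) UU) col_mulmx.
Qed.

Lemma sum_sqr_le (I : finType) (s : I -> R) : (forall i, 0 <= s i) ->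
  \sum_i s i ^+ 2 <= (\sum_i s i) ^+ 2.
Proof.
move=> s0; rewrite [leRHS]expr2 mulr_suml; apply: ler_sum => i _.
rewrite expr2 ler_wpM2l // (bigD1 i) //= lerDl.
by apply: sumr_ge0 => j _.
Qed.

Lemma frob_le_norm21 A : frob A <= norm21 A ^+ 2.
Proof.
rewrite /frob -(pair_bigA _ (fun i j => A i j ^+ 2)) /=.
have -> : \sum_i \sum_j A i j ^+ 2 =
    \sum_i Num.sqrt (\sum_j A i j ^+ 2) ^+ 2.
  apply: eq_bigr => i _; rewrite sqr_sqrtr //.
  by apply: sumr_ge0 => j _; exact: sqr_ge0.
by apply: sum_sqr_le => i; exact: sqrtr_ge0.
Qed.

(** Moves [U] from the data to the weights. The Frobenius norm is invariant under this rotation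
    while the (2,1)-norm is not, hence the passage to [frob]. *)
Lemma predict_rotate A a U (t : 'I_T) (x : d.-tuple R) :
  predict A a U t x = dotv (col t (U *m A) + U *m a) (vec_of x).
Proof. by rewrite /predict dotv_mulmx mulmxDr col_mulmx. Qed.

(** Two linear functionals of the weights: [x] placed in the column of its task for [A], and [x]
    itself for the shared [a]. *)
Lemma dotv_col_add A a (t : 'I_T) (x : d.-tuple R) :
  dotv (col t A + a) (vec_of x) =
  \sum_(q : 'I_d * 'I_T) A q.1 q.2 * (if q.2 == t then tnth x q.1 else 0) +
  \sum_(i < d) a i 0 * tnth x i.
Proof.
rewrite -(pair_bigA _ (fun i j => A i j * (if j == t then tnth x i else 0))) /=.
rewrite -big_split; apply: eq_bigr => i _ /=.
rewrite !mxE mulrDl; congr (_ + _).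
by rewrite (bigD1 t) //= eqxx big1 ?addr0 // => j /negPf ->; rewrite mulr0.
Qed.

Lemma sum_sqr_task (t : 'I_T) (x : d.-tuple R) :
  \sum_(q : 'I_d * 'I_T) (if q.2 == t then tnth x q.1 else 0) ^+ 2 =
  sqnorm (vec_of x).
Proof.
rewrite -(pair_bigA _ (fun i j => (if j == t then tnth x i else 0) ^+ 2)) /=.
apply: eq_bigr => i _; rewrite !mxE -expr2 (bigD1 t) //= eqxx big1 ?addr0 //.
by move=> j /negPf ->; rewrite expr0n.
Qed.

End linear_algebra.

(** Rounding towards zero, so that approximating the entries does not leave the balls. *)
Lemma rat_approx {R : realType} (x e : R) : 0 < e ->
  exists q : rat, `|ratr q| <= `|x| /\ `|x - ratr q| < e.
Proof.
move=> e0; wlog x0 : x / 0 <= x.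
  move=> H; have [|x0] := leP 0 x; first exact: H.
  have [|q [qx xq]] := H (- x); first by rewrite oppr_ge0 ltW.
  move: qx xq; rewrite normrN -opprD normrN => qx xq.
  by exists (- q); rewrite rmorphN normrN opprK.
have [->|xn0] := eqVneq x 0; first by exists 0; rewrite rmorph0 subrr normr0.
have lt : Order.max 0 (x - e) < x.
  by rewrite gt_max lt_neqAle eq_sym xn0 x0 /= ltrBlDr ltrDl.
have [q] := rat_in_itvoo lt; rewrite in_itv /= gt_max => /andP[/andP[q0 eq] qx].
exists q; rewrite (ger0_norm (ltW q0)) (ger0_norm x0) (ltW qx); split => //.
by rewrite ger0_norm ?subr_ge0 ?(ltW qx) //; lra.
Qed.

Lemma lipschitz_cvg {R : realType} (f : R -> R) (c : R) (u : nat -> R) (x : R) :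
  0 <= c -> (forall y z, `|f y - f z| <= c * `|y - z|) ->
  u @ \oo --> x -> (fun n => f (u n)) @ \oo --> f x.
Proof.
move=> c0 fc /cvgrPdist_lt ux; apply/cvgrPdist_lt => e e0.
(* Dividing by [c + 1] covers the case [c = 0]. *)
have c1 : 0 < c + 1 by lra.
near=> n.
have un : `|x - u n| < e / (c + 1) by near: n; apply: ux; exact: divr_gt0.
apply: le_lt_trans (fc _ _) _.
apply: (@le_lt_trans _ _ ((c + 1) * `|x - u n|)).
  by rewrite ler_wpM2r // lerDl.
by rewrite mulrC -ltr_pdivlMr.
Unshelve. all: by end_near.
Qed.

Section countable_class.
#[local] Set Implicit Arguments.
Context {R : realType} {d T : nat} (r1 r2 : R).
Hypotheses (r1_ge0 : 0 <= r1) (r2_ge0 : 0 <= r2).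

Definition in_balls (h : 'M[R]_(d, T) * 'cV[R]_d) : bool :=
  (frob h.1 <= r1) && (sqnorm h.2 <= r2).

Definition rat_pair (q : 'M[rat]_(d, T) * 'cV[rat]_d) : 'M[R]_(d, T) * 'cV[R]_d :=
  (map_mx ratr q.1, map_mx ratr q.2).

(** An enumeration of the rational pairs in the balls. A number that codes no pair, or codes a pair
    outside the balls, is sent to the zero pair, so every index gives a member of the class. *)
Definition rat_hyp (k : nat) : 'M[R]_(d, T) * 'cV[R]_d :=
  let h := oapp rat_pair (0, 0) (unpickle k) in if in_balls h then h else (0, 0).

Lemma rat_hyp_in_balls k : in_balls (rat_hyp k).
Proof.
rewrite /rat_hyp; case: ifP => // _; apply/andP; split => /=.
  by rewrite /frob big1 // => q _; rewrite mxE expr0n.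
by rewrite /sqnorm /dotv big1 // => q _; rewrite mxE mul0r.
Qed.

Lemma rat_hyp_dense A a : in_balls (A, a) -> exists k : nat -> nat,
  (forall i j, (fun n => (rat_hyp (k n)).1 i j) @ \oo --> A i j) /\
  (forall i, (fun n => (rat_hyp (k n)).2 i 0) @ \oo --> a i 0).
Proof.
move=> Aa.
have ex n (x : R) : {q : rat | `|ratr q| <= `|x| /\ `|x - ratr q| < n.+1%:R^-1}.
  by apply: cid; apply: rat_approx; rewrite invr_gt0.
pose q n (x : R) : rat := sval (ex n x).
have qP n x : `|ratr (q n x)| <= `|x| /\ `|x - ratr (q n x)| < n.+1%:R^-1.
  by rewrite /q; case: (ex n x).
pose Q n := (map_mx (q n) A, map_mx (q n) a).
have sq n x : ratr (q n x) ^+ 2 <= x ^+ 2.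
  have [h _] := qP n x; rewrite -(real_normK (num_real x)).
  by rewrite -(real_normK (num_real (ratr _))) ler_sqr ?nnegrE.
have ballQ n : in_balls (rat_pair (Q n)).
  case/andP: Aa => hA ha; apply/andP; split.
    by apply: le_trans hA; apply: ler_sum => -[i j] _ /=; rewrite !mxE.
  by apply: le_trans ha; apply: ler_sum => i _ /=; rewrite !mxE -!expr2.
have hypQ n : rat_hyp (pickle (Q n)) = rat_pair (Q n).
  by rewrite /rat_hyp pickleK /= ballQ.
have qcvg x : (fun n => ratr (q n x) : R) @ \oo --> x.
  apply/cvgrPdist_lt => e e0; near=> n.
  have [_ h] := qP n x; apply: lt_trans h _; near: n.
  exact: near_infty_natSinv_lt (PosNum e0).
exists (fun n => pickle (Q n)); split => [i j|i].
  by under eq_fun do rewrite hypQ !mxE; exact: qcvg.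
by under eq_fun do rewrite hypQ !mxE; exact: qcvg.
Unshelve. all: by end_near.
Qed.

End countable_class.

(** * Generalization bound *)

Lemma cvg_fsum {R : realType} (J : Type) (s : seq J) (u : J -> nat -> R) (x : J -> R) :
  (forall j, u j @ \oo --> x j) ->
  (fun n => \sum_(j <- s) u j n) @ \oo --> \sum_(j <- s) x j.
Proof.
move=> ux; elim: s => [|j s IH].
  by rewrite big_nil; under eq_fun do rewrite big_nil; exact: cvg_cst.
by rewrite big_cons; under eq_fun do rewrite big_cons; exact: cvgD.
Qed.

(** When [d > 0], linear functions take any two prescribed values [u] and [v] at a basis vector, so
    admissibility is a full Lipschitz condition. *)
Lemma admissible_lipschitz {R : realType} {d : nat} (l : R -> R -> R) (c : R) :
  (0 < d)%N -> admissible_linear d l c ->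
  forall y u v, `|l y u - l y v| <= c * `|u - v|.
Proof.
move=> d0 [_ lc] y u v; pose i0 := Ordinal d0.
pose e (s : R) : 'cV[R]_d := \col_i (if i == i0 then s else 0).
have de s : dotv (e s) (e 1) = s.
  rewrite /dotv (bigD1 i0) //= !mxE eqxx mulr1 big1 ?addr0 // => i /negPf h.
  by rewrite !mxE h mul0r.
by have := lc (e u) (e v) (e 1) y; rewrite !de.
Qed.

Section generalization.
#[local] Set Implicit Arguments.
Context {R : realType} {T d : nat} (hd : (0 < d)%N).
Context (gamma beta : R) (hgamma : 0 < gamma) (hbeta : 0 < beta).
Context {dO : measure_display} {Omega : measurableType dO} (P : probability Omega R).
Context (m : 'I_T -> nat) (hT : (0 < T)%N) (hm : forall t, (0 < m t)%N).
Context (mu : 'I_T -> probability (d.-tuple R * R)%type R).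
Context (Z : forall t : 'I_T, 'I_(m t) -> Omega -> (d.-tuple R * R)%type).
Hypothesis hZmeas : forall t i, measurable_fun setT (@Z t i).
Hypothesis hZdist : forall t i (E : set (d.-tuple R * R)%type), measurable E ->
  P (@Z t i @^-1` E) = mu t E.
Hypothesis hZindep : mutually_independent P
  (fun k : {t : 'I_T & 'I_(m t)} => Z (tagged k)).
Context (l : R -> R -> R) (B c : R).
Hypothesis hlmeas : measurable_fun setT (fun p : R * R => l p.1 p.2).
Hypothesis hlbound : forall y p, 0 <= l y p <= B.
Hypothesis hladm : admissible_linear d l c.

Let lin (h : 'M[R]_(d, T) * 'cV[R]_d) (t : 'I_T) (x : d.-tuple R) : R :=
  dotv (col t h.1 + h.2) (vec_of x).

Let loss h t (z : d.-tuple R * R) : R := l z.2 (lin h t z.1).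

Let c_ge0 : 0 <= c. Proof. by case: hladm. Qed.

Let l_lip := admissible_lipschitz l c hd hladm.

Let measurable_lin h t : measurable_fun setT (lin h t).
Proof.
apply: measurable_sum => i; apply: measurable_funM => //.
under eq_fun do rewrite mxE.
exact: measurable_tnth.
Qed.

Let bmeas_loss h t : bmeas (loss h t).
Proof.
split.
  apply: (measurableT_comp hlmeas (g := fun z => (z.2, lin h t z.1))).
  apply/measurable_fun_pair => //=.
  exact: measurableT_comp (measurable_lin h t) _.
by exists B => z; have /andP[? ?] := hlbound z.2 (lin h t z.1); rewrite ger0_norm.
Qed.

Let deviation h w : R :=
  \sum_(t < T) (m t)%:R * (\int[mu t]_z loss h t z)%R -
  \sum_(t < T) \sum_(i < m t) loss h t (Z i w).

Let bound delta w : R :=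
  2 * c * (Num.sqrt (T%:R / gamma) + Num.sqrt (beta^-1))
    * Num.sqrt (\sum_(t < T) (m t)%:R * S_t (fun i : 'I_(m t) => (Z i w).1))
  + 3 * B * Num.sqrt ((\sum_(t < T) (m t)%:R) * ln (2 / delta) / 2).

(** The samples of all tasks are flattened into one independent, not identically distributed,
    sequence [X]; [task] recovers the task of an index. *)
Let J := {t : 'I_T & 'I_(m t)}.
Let X (k : 'I_#|{: J}|) := Z (tagged (enum_val k)).
Let task (k : 'I_#|{: J}|) := tag (enum_val k).
Let H := rat_hyp (R := R) (d := d) (T := T) (T%:R / gamma) beta^-1.

Let r1_ge0 : 0 <= T%:R / gamma. Proof. by rewrite divr_ge0 // ltW. Qed.

Let r2_ge0 : 0 <= beta^-1. Proof. by rewrite invr_ge0 ltW. Qed.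

Let sum_sqnorm w : \sum_k sqnorm (vec_of (X k w).1) =
  \sum_(t < T) (m t)%:R * S_t (fun i : 'I_(m t) => (Z i w).1).
Proof.
rewrite (sum_samples _ m (fun s : J => sqnorm (vec_of (Z (tagged s) w).1))).
apply: eq_bigr => t _; rewrite /S_t mulrA divff ?mul1r //.
by rewrite pnatr_eq0 -lt0n.
Qed.

(** Contraction with constant [2 c] leaves a linear class. Placing [x] in the column of its task
    keeps its norm, so both feature families have the same total squared norm and the two radii
    factor out. *)
Let rad_le (p : nat) w :
  rad (fun k (h : 'I_p.+1) => 2 * loss (H h) (task k) (X k w)) (fun=> 0) <=
  2 * c * (Num.sqrt (T%:R / gamma) + Num.sqrt (beta^-1))
    * Num.sqrt (\sum_(t < T) (m t)%:R * S_t (fun i : 'I_(m t) => (Z i w).1)).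
Proof.
have c2 : 0 <= 2 * c by rewrite mulr_ge0.
have := rad_contract _ (fun k x => 2 * l (X k w).2 x) (2 * c)
  (fun k (h : 'I_p.+1) => lin (H h) (task k) (X k w).1) (fun=> 0) c2.
move=> contr; apply: le_trans (contr _) _.
  by move=> k x y; rewrite -mulrBr normrM ger0_norm // -mulrA ler_pM2l.
pose W (h : 'I_p.+1) (q : 'I_d * 'I_T) := 2 * c * (H h).1 q.1 q.2.
pose W0 (h : 'I_p.+1) (i : 'I_d) := 2 * c * (H h).2 i 0.
pose y k (q : 'I_d * 'I_T) := if q.2 == task k then tnth (X k w).1 q.1 else 0.
pose y0 k (i : 'I_d) := tnth (X k w).1 i.
have := rad_linear_le _ _ _ W W0 y y0 (fun=> 0) (fun=> 0)
  (2 * c * Num.sqrt (T%:R / gamma)) (2 * c * Num.sqrt (beta^-1)).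
have e1 : (fun (k : 'I_#|{: J}|) (h : 'I_p.+1) => 2 * c * lin (H h) (task k) (X k w).1) =
   (fun k h => \sum_q W h q * y k q + \sum_q W0 h q * y0 k q).
  apply/funext => k; apply/funext => h; rewrite /lin dotv_col_add mulrDr !mulr_sumr.
  by congr (_ + _); apply: eq_bigr => q _; rewrite mulrA.
have e2 : (fun h : 'I_p.+1 => \sum_q W h q * 0 + \sum_q W0 h q * 0) = (fun=> 0).
  by apply/funext => h; rewrite !big1 ?addr0 // => q _; rewrite mulr0.
have e3 : \sum_k \sum_q y k q ^+ 2 = \sum_k sqnorm (vec_of (X k w).1).
  by apply: eq_bigr => k _; exact: sum_sqr_task.
have e4 : \sum_k \sum_q y0 k q ^+ 2 = \sum_k sqnorm (vec_of (X k w).1).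
  apply: eq_bigr => k _; apply: eq_bigr => i _; by rewrite !mxE expr2.
have z2 (I : finType) : \sum_(q : I) (0 : R) ^+ 2 = 0 by rewrite big1 // => q _; rewrite expr0n.
rewrite e1 e2 e3 e4 !z2 !add0r sum_sqnorm => lin_le.
apply: le_trans (lin_le _ _ _ _) _; first by rewrite mulr_ge0 ?sqrtr_ge0.
- by rewrite mulr_ge0 ?sqrtr_ge0.
- move=> h; have /andP[hA _] := rat_hyp_in_balls (d:=d) (T:=T) _ _ r1_ge0 r2_ge0 h.
  rewrite /W exprMn sqr_sqrtr //; under eq_bigr do rewrite exprMn.
  by rewrite -mulr_sumr ler_wpM2l // sqr_ge0.
- move=> h; have /andP[_ ha] := rat_hyp_in_balls (d:=d) (T:=T) _ _ r1_ge0 r2_ge0 h.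
  rewrite /W0 exprMn sqr_sqrtr //; under eq_bigr do rewrite exprMn.
  rewrite -mulr_sumr ler_wpM2l ?sqr_ge0 //; apply: le_trans ha.
by rewrite mulrDr mulrDl.
Qed.

Let integral_loss h k : (\int[P]_w loss h (task k) (X k w))%R =
  (\int[mu (task k)]_z loss h (task k) z)%R.
Proof. by apply: Rintegral_law => [|E mE|]; [exact: hZmeas|exact: hZdist|]. Qed.

Let sum_deviation h w :
  \sum_k ((\int[P]_w' loss h (task k) (X k w'))%R - loss h (task k) (X k w)) =
  deviation h w.
Proof.
under eq_bigr do rewrite integral_loss.
rewrite (sum_samples _ m (fun s : J =>
  (\int[mu (tag s)]_z loss h (tag s) z)%R - loss h (tag s) (Z (tagged s) w))).
rewrite /deviation -sumrB; apply: eq_bigr => t _ /=.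
by rewrite sumrB sumr_const card_ord mulr_natl.
Qed.

Let card_samples : #|{: J}|%:R = \sum_(t < T) (m t)%:R :> R.
Proof.
transitivity (\sum_(k < #|{: J}|) (1 : R)); first by rewrite sumr_const card_ord.
rewrite (sum_samples _ m (fun=> 1)).
by apply: eq_bigr => t _; rewrite sumr_const card_ord.
Qed.

Let finite_class (delta : R) (p : nat) : 0 < B -> 0 < delta < 1 ->
  exists E : set Omega, [/\ measurable E, ((1 - delta)%:E <= P E)%E &
    forall w, E w -> forall h : 'I_p.+1, deviation (H h) w <= bound delta w].
Proof.
move=> B0 delta01.
have n0 : (0 < #|{: J}|)%N.
  by rewrite -(ltr0n R) card_samples (bigD1 (Ordinal hT)) //= ltr_pwDl ?ltr0n // sumr_ge0.
have [E [mE PE devE]] := uniform_deviation (P := P) (X := X)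
  (fun k (h : 'I_p.+1) => loss (H h) (task k)) _ _ n0 B0 delta01
  (fun k => hZmeas _) (mutually_independent_enum hZindep)
  (fun k h => proj1 (bmeas_loss _ _)) (fun k h z => hlbound _ _).
exists E; split => // w Ew h; rewrite -sum_deviation.
apply: le_trans (devE w Ew h) _; rewrite /bound card_samples lerD2r.
exact: rad_le.
Qed.

Let deviation_cvg (h : 'M[R]_(d, T) * 'cV[R]_d) (k : nat -> nat) w :
  (forall i j, (fun n => (H (k n)).1 i j) @ \oo --> h.1 i j) ->
  (forall i, (fun n => (H (k n)).2 i 0) @ \oo --> h.2 i 0) ->
  (fun n => deviation (H (k n)) w) @ \oo --> deviation h w.
Proof.
move=> cA ca.
have clin t x : (fun n => lin (H (k n)) t x) @ \oo --> lin h t x.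
  rewrite /lin /dotv; apply: cvg_fsum => i; apply: cvgMl.
  by rewrite !mxE; under eq_fun do rewrite !mxE; exact: cvgD.
have closs t z : (fun n => loss (H (k n)) t z) @ \oo --> loss h t z.
  exact: (lipschitz_cvg _ _ _ _ c_ge0 (l_lip z.2) (clin t z.1)).
apply: cvgB; apply: cvg_fsum => t; last by apply: cvg_fsum => i; exact: closs.
apply: cvgMr; apply: (Rintegral_bounded_cvg _ _ B) => //.
- by move=> n; case: (bmeas_loss (H (k n)) t).
- by case: (bmeas_loss h t).
- move=> n z; have /andP[? ?] := hlbound z.2 (lin (H (k n)) t z.1).
  by rewrite ger0_norm.
Qed.

(** The event is chosen before the feasible point, so the bound can be used at a point that depends
    on the data. *)
Lemma generalization_bound (delta : R) : 0 < delta ->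
  exists E : set Omega, measurable E /\ ((1 - delta)%:E <= P E)%E /\
    forall w, E w -> forall A a0 U, feasible gamma beta A a0 U ->
    \sum_(t < T) (m t)%:R *
        Rintegral (mu t) setT (fun z => l z.2 (predict A a0 U t z.1))
    - emp_obj l (fun t i => @Z t i w) A a0 U <= bound delta w.
Proof.
(* For [delta >= 1] the empty event suffices. *)
move=> delta0; have [delta1|delta1] := leP 1 delta.
  exists set0; split; first exact: measurable0.
  by split=> //; rewrite measure0 lee_fin subr_le0.
have deviationE A a0 U w : deviation (U *m A, U *m a0) w =
    \sum_(t < T) (m t)%:R *
        Rintegral (mu t) setT (fun z => l z.2 (predict A a0 U t z.1))
    - emp_obj l (fun t i => @Z t i w) A a0 U.
  rewrite /deviation /emp_obj /loss /lin; congr (_ - _).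
    apply: eq_bigr => t _; congr (_ * _); apply: eq_Rintegral => z _.
    by rewrite predict_rotate.
  by apply: eq_bigr => t _; apply: eq_bigr => i _; rewrite predict_rotate.
(* [uniform_deviation] requires [B > 0]. Otherwise the loss is identically 0 and the whole space
   serves as the event. *)
have [B0|B0] := leP B 0.
  have l0 y p : l y p = 0.
    have /andP[? ?] := hlbound y p; apply/eqP; rewrite eq_le; apply/andP; split=> //.
    exact: le_trans B0.
  have B_eq0 : B = 0.
    by apply/eqP; rewrite eq_le B0 -(l0 0 0); case/andP: (hlbound 0 0).
  exists setT; split; first exact: measurableT.
  split; first by rewrite probability_setT lee_fin gerBl ltW.
  move=> w _ A a0 U _; rewrite -deviationE /deviation /loss.
  under eq_bigr do under eq_Rintegral do rewrite l0.
  under [X in _ - X]eq_bigr do under eq_bigr do rewrite l0.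
  rewrite big1 => [|t _]; last by rewrite Rintegral_probability_cst mulr0.
  rewrite big1 => [|t _]; last by rewrite big1.
  rewrite subrr /bound B_eq0 mulr0 mul0r addr0.
  by rewrite !mulr_ge0 ?addr_ge0 ?sqrtr_ge0.
have ch p := finite_class _ p B0 (introT andP (conj delta0 delta1)).
pose E p := sval (cid (ch p)).
have EP p : [/\ measurable (E p), ((1 - delta)%:E <= P (E p))%E &
    forall w, E p w -> forall h : 'I_p.+1, deviation (H h) w <= bound delta w].
  by rewrite /E; case: (cid (ch p)).
have [F [mF PF oF]] := often_event P _ E (fun p => let: And3 h _ _ := EP p in h)
  (fun p => let: And3 _ h _ := EP p in h).
exists F; split => //; split => // w Fw A a0 U [hA [ha hU]].
have balls : in_balls (T%:R / gamma) beta^-1 (U *m A, U *m a0).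
  rewrite /in_balls /= frob_isometry // sqnorm_isometry // ha andbT.
  exact: le_trans (frob_le_norm21 A) hA.
(* Each approximant has some index [k n], and [w] lies in [E p] for some [p >= k n], whose class
   contains it. The bound does not depend on [p] and passes to the limit. *)
have [k [kA ka]] := rat_hyp_dense _ _ _ _ balls.
have dc := deviation_cvg (U *m A, U *m a0) k w kA ka.
rewrite -deviationE; apply: (cvgr_to_le dc).
apply: nearW => n; have [p kp Ep] := oF w Fw (k n).
have [_ _ /(_ w Ep)] := EP p.
by move=> /(_ (Ordinal (kp : (k n < p.+1)%N))).
Qed.

End generalization.

(** * Equal sample sizes, bounded inputs and the final statement *)

Lemma sqnorm_ge0 {R : realType} {d : nat} (u : 'cV[R]_d) : 0 <= sqnorm u.
Proof. by apply: sumr_ge0 => i _; rewrite -expr2 sqr_ge0. Qed.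

(** Extracts the factor [n] by which the first bound is divided to obtain the averaged one. *)
Lemma sqrt_mul_eq {R : realType} (x y z n : R) :
  0 <= x -> 0 <= n -> 0 <= z -> x * y = n ^+ 2 / z ->
  Num.sqrt x * Num.sqrt y = n / Num.sqrt z.
Proof.
move=> x0 n0 z0 xy; rewrite -sqrtrM // xy sqrtrM ?sqr_ge0 //.
by rewrite sqrtr_sqr ger0_norm // sqrtrV.
Qed.

Lemma probability_setI_full {R : realType} {dO : measure_display}
    {Omega : measurableType dO} (P : probability Omega R) (E G : set Omega) :
  measurable E -> measurable G -> P G = 1%E -> (P E <= P (E `&` G))%E.
Proof.
move=> mE mG PG.
have PGC : P (~` G) = 0%E by rewrite probability_setC // PG subee.
have mEG := measurableI _ _ mE mG; have mGC := measurableC mG.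
apply: (@le_trans _ _ (P (E `&` G `|` ~` G))).
  apply: le_measure; rewrite ?inE //; first exact: measurableU.
  by move=> w Ew; have [Gw|nGw] := pselect (G w); [left|right].
by apply: le_trans (measureU2 P mEG mGC) _; rewrite -[X in (_ + X)%E]/(P (~` G)) PGC adde0.
Qed.

Theorem theorem2 (R : realType) (T d : nat) (hT : (0 < T)%N) (hd : (0 < d)%N)
  (gamma beta : R) (hgamma : 0 < gamma) (hbeta : 0 < beta)
  (dO : measure_display) (Omega : measurableType dO) (P : probability Omega R)
  (m : 'I_T -> nat) (hm : forall t, (0 < m t)%N)
  (mu : 'I_T -> probability (d.-tuple R * R)%type R)
  (Z : forall t : 'I_T, 'I_(m t) -> Omega -> (d.-tuple R * R)%type)
  (hZmeas : forall t i, measurable_fun setT (Z t i))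
  (hZdist : forall t i (E : set (d.-tuple R * R)%type), measurable E ->
     P (Z t i @^-1` E) = mu t E)
  (hZindep : mutually_independent P
     (fun k : {t : 'I_T & 'I_(m t)} => Z (tag k) (tagged k)))
  (l : R -> R -> R) (B c : R)
  (hlmeas : measurable_fun setT (fun p : R * R => l p.1 p.2))
  (hlbound : forall y p, 0 <= l y p <= B)
  (hladm : admissible_linear d l c)
  (solA : Omega -> 'M[R]_(d, T)) (sola0 : Omega -> 'cV[R]_d) (solU : Omega -> 'M[R]_d)
  (hsol : forall w : Omega,
     feasible gamma beta (solA w) (sola0 w) (solU w) /\
     forall A a0 U, feasible gamma beta A a0 U ->
       emp_obj l (fun t i => Z t i w) (solA w) (sola0 w) (solU w)
       <= emp_obj l (fun t i => Z t i w) A a0 U) :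
  (forall delta : R, 0 < delta ->
     exists E : set Omega, measurable E /\ (P E >= (1 - delta)%:E)%E /\
       forall w, E w ->
         \sum_(t < T) (m t)%:R *
            Rintegral (mu t) setT
              (fun z => l z.2 (predict (solA w) (sola0 w) (solU w) t z.1))
         - emp_obj l (fun t i => Z t i w) (solA w) (sola0 w) (solU w)
         <= 2 * c * (Num.sqrt (T%:R / gamma) + Num.sqrt (beta^-1))
              * Num.sqrt (\sum_(t < T) (m t)%:R * S_t (fun i => (Z t i w).1))
            + 3 * B * Num.sqrt ((\sum_(t < T) (m t)%:R) * ln (2 / delta) / 2))
  /\
  (forall (m0 : nat) (r : R), (forall t, m t = m0) ->
     (forall t, mu t [set z | norm2 (vec_of z.1) <= r] = 1%E) ->
     forall delta : R, 0 < delta ->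
     exists E : set Omega, measurable E /\ (P E >= (1 - delta)%:E)%E /\
       forall w, E w ->
         T%:R^-1 * \sum_(t < T)
            Rintegral (mu t) setT
              (fun z => l z.2 (predict (solA w) (sola0 w) (solU w) t z.1))
         - T%:R^-1 * \sum_(t < T) (m0%:R^-1 *
              \sum_(i < m t) l (Z t i w).2 (predict (solA w) (sola0 w) (solU w) t (Z t i w).1))
         <= 2 * c * r / Num.sqrt (gamma * m0%:R)
            + 2 * c * r / Num.sqrt (beta * m0%:R * T%:R)
            + 3 * B * Num.sqrt (ln (2 / delta) / (2 * m0%:R * T%:R))).
Proof.
have T0 : 0 < T%:R :> R by rewrite ltr0n.
have gb := generalization_bound hd _ _ hgamma hbeta _ hT hm mu _ hZmeas hZdist
  hZindep _ hlmeas hlbound hladm.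
split=> [delta delta0|m0 r mE mu_r delta delta0]; have [E [mE' [PE devE]]] := gb delta delta0.
  exists E; split => //; split => // w Ew.
  exact: (devE w Ew _ _ _ (proj1 (hsol w))).
have m00 : (0 < m0)%N by rewrite -(mE (Ordinal hT)).
have m0R : 0 < m0%:R :> R by rewrite ltr0n.
(* For negative [r] the ball would be empty, yet it has probability one. *)
have r0 : 0 <= r.
  rewrite leNgt; apply/negP => rn; have := mu_r (Ordinal hT).
  rewrite (_ : [set z | _] = set0); last first.
    by apply/seteqP; split => // z /= /(le_trans (sqrtr_ge0 _)); rewrite leNgt rn.
  by rewrite measure0 => /eqP; rewrite eq_sym onee_eq0.
pose ball : set (d.-tuple R * R) := [set z | norm2 (vec_of z.1) <= r].
have norm2_le (u : 'cV[R]_d) : (norm2 u <= r) = (sqnorm u <= r ^+ 2).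
  by rewrite -ler_sqr ?nnegrE ?sqrtr_ge0 // sqr_sqrtr ?sqnorm_ge0.
have mball : measurable ball.
  rewrite (_ : ball = setT `&` [set z | sqnorm (vec_of z.1) <= r ^+ 2]); last first.
    by rewrite setTI /ball; apply: eq_set => z; rewrite norm2_le.
  apply: measurable_fun_le => //; apply: measurable_sum => i.
  under eq_fun do rewrite !mxE.
  have mt : measurable_fun setT (fun z : d.-tuple R * R => tnth z.1 i).
    exact: measurableT_comp (measurable_tnth i) measurable_fst.
  exact: measurable_funM.
(* The norm bound holds only almost surely. [G] is the event that all samples satisfy it; it has
   probability one by the product rule, so intersecting with it costs nothing. *)
pose G := \bigcap_(k in [set: {t : 'I_T & 'I_(m t)}]) (Z (tag k) (tagged k) @^-1` ball).
have mG : measurable G.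
  apply: fin_bigcap_measurable => [|k _]; first exact: finite_finset.
  by rewrite -[X in measurable X]setTI; exact: hZmeas.
have PG : P G = 1%E.
  rewrite (hZindep (fun=> ball)) // big1 // => k _.
  by rewrite hZdist.
exists (E `&` G); split; first exact: measurableI.
split; first exact: le_trans PE (probability_setI_full P E G mE' mG PG).
move=> w [Ew Gw]; have := devE w Ew _ _ _ (proj1 (hsol w)).
set A := solA w; set a0 := sola0 w; set U := solU w.
pose N : R := T%:R * m0%:R.
have N0 : 0 < N by rewrite mulr_gt0.
have sum_m : \sum_(t < T) (m t)%:R = N.
  by under eq_bigr do rewrite mE; rewrite sumr_const card_ord /N mulr_natl.
have S_le : \sum_(t < T) (m t)%:R * S_t (fun i => (Z t i w).1) <= N * r ^+ 2.
  rewrite -sum_m mulr_suml; apply: ler_sum => t _.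
  rewrite ler_wpM2l // /S_t ler_pdivrMl ?ltr0n //.
  apply: (@le_trans _ _ (\sum_(i < m t) r ^+ 2)).
    apply: ler_sum => i _; rewrite -norm2_le.
    exact: (Gw (Tagged (fun t => 'I_(m t)) i)).
  by rewrite sumr_const card_ord mulr_natl.
rewrite sum_m.
set risk := \sum_(t < T) (m t)%:R * _; set emp := emp_obj _ _ _ _ _ => dev.
(* The averaged deviation is the total one divided by the number [N] of samples; it remains to
   divide the first bound by [N], using [S_le]. *)
have lhsE : T%:R^-1 * \sum_(t < T)
      Rintegral (mu t) setT (fun z => l z.2 (predict A a0 U t z.1))
    - T%:R^-1 * \sum_(t < T) (m0%:R^-1 *
      \sum_(i < m t) l (Z t i w).2 (predict A a0 U t (Z t i w).1)) = (risk - emp) / N.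
  have -> : risk = m0%:R * \sum_(t < T)
      Rintegral (mu t) setT (fun z => l z.2 (predict A a0 U t z.1)).
    by rewrite mulr_sumr; apply: eq_bigr => t _; rewrite mE.
  by rewrite -mulr_sumr -/(emp_obj _ _ _ _ _) -/emp /N; field; rewrite !gt_eqF.
rewrite lhsE ler_pdivrMr //; apply: le_trans dev _.
set x1 := Num.sqrt (T%:R / gamma); set x2 := Num.sqrt beta^-1.
have c0 : 0 <= c by case: hladm.
have sqN : Num.sqrt (N * r ^+ 2) = Num.sqrt N * r.
  by rewrite sqrtrM ?ltW // sqrtr_sqr ger0_norm.
have e1 : x1 * Num.sqrt N = N / Num.sqrt (gamma * m0%:R).
  apply: sqrt_mul_eq; rewrite ?divr_ge0 ?mulr_ge0 // ?ltW //.
  by rewrite /N; field; rewrite !gt_eqF.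
have e2 : x2 * Num.sqrt N = N / Num.sqrt (beta * m0%:R * T%:R).
  apply: sqrt_mul_eq; rewrite ?invr_ge0 ?mulr_ge0 // ?ltW //.
  by rewrite /N; field; rewrite !gt_eqF.
have e3 : Num.sqrt (N * ln (2 / delta) / 2) = N * Num.sqrt (ln (2 / delta) / (2 * m0%:R * T%:R)).
  rewrite -[X in X * Num.sqrt _](ger0_norm (ltW N0)) -sqrtr_sqr -sqrtrM ?sqr_ge0 //.
  by congr Num.sqrt; rewrite /N; field; rewrite !gt_eqF // mulr_gt0.
apply: (@le_trans _ _ (2 * c * (x1 + x2) * (Num.sqrt N * r) +
    3 * B * Num.sqrt (N * ln (2 / delta) / 2))).
  rewrite lerD2r -sqN ler_wpM2l ?ler_wsqrtr //.
  by rewrite !mulr_ge0 ?addr_ge0 ?sqrtr_ge0.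
have -> : 2 * c * (x1 + x2) * (Num.sqrt N * r) =
    2 * c * r * (x1 * Num.sqrt N) + 2 * c * r * (x2 * Num.sqrt N).
  by ring.
rewrite e1 e2 e3 le_eqVlt; apply/orP; left; apply/eqP; ring.
Qed.
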